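(* $\mu (\Omega) \leq 2q^{-(q+1)}$.
   Context: Let $q$ be a prime power. For $d\ge 1$ let $R_d\subseteq\mathbb{F}_q[x,y,z]$ be the $\mathbb{F}_q$-vector space of homogeneous polynomials of degree $d$ (including $0$), and $R_{\mathrm{hom}}=\bigcup_{d\ge1}R_d$. The density of $\mathcal{P}\subseteq R_{\mathrm{hom}}$ is $\mu(\mathcal{P})=\lim_{d\to\infty}|\mathcal{P}\cap R_d|/|R_d|$. For $f\in R_{\mathrm{hom}}$, $C_f=\{f=0\}\subseteq\mathbb{P}^2$ is the (possibly non-reduced) curve defined by $f$ ($C_f=\mathbb{P}^2$ if $f=0$). ''Line'' always means a line of $\mathbb{P}^2$ defined over $\mathbb{F}_q$. A line $\ell$ is transverse to $C_f$ if the scheme-theoretic intersection $C_f\cap\ell$ is smooth of dimension $0$ (the empty scheme counts as smooth of any dimension), i.e. $\ell$ meets $C_f$ with multiplicity $1$ at every closed point of $C_f\cap\ell$. $C_f$ is transverse-free if no line is transverse to it, i.e. every line meets $C_f$ at some closed point with multiplicity at least $2$ (a line contained in $C_f$ counts). $\Omega=\{f\in R_{\mathrm{hom}}: C_f\text{ is transverse-free}\}$. *)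

(* Defs.v *)
From HB Require Import structures.
From mathcomp Require Import all_boot all_order all_algebra all_field.
From mathcomp Require Import mpoly.

Set Implicit Arguments.
Unset Strict Implicit.
Unset Printing Implicit Defensive.

Import GRing.Theory.
Local Open Scope ring_scope.

From Stdlib Require ClassicalEpsilon.

Definition asbool (P : Prop) : bool :=
  if ClassicalEpsilon.excluded_middle_informative P then true else false.

Section Defs.
Variable F : finFieldType.

Definition mon (d : nat) := {m : 'X_{1..3 < d.+1} | mdeg (val m) == d}.

(* The homogeneous polynomial of degree d with coefficient vector c.
   c |-> poly_of_coefs c is a bijection {ffun mon d -> F} ~ R_d. *)
Definition poly_of_coefs (d : nat) (c : {ffun mon d -> F}) : {mpoly F[3]} :=
  \sum_(m : mon d) c m *: 'X_[val (val m)].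

(* Parametrisation of the line spanned by the points P, Q of P^2(F_q):
   (s : t) |-> s P + t Q; binary forms live in {mpoly F[2]} (variables s, t). *)
Definition line_param (P Q : 'rV[F]_3) : 3.-tuple {mpoly F[2]} :=
  [tuple P ord0 i *: 'X_(@ord0 1) + Q ord0 i *: 'X_(@ord_max 1) | i < 3].

Definition restrict (f : {mpoly F[3]}) (P Q : 'rV[F]_3) : {mpoly F[2]} :=
  comp_mpoly (line_param P Q) f.

(* Closed points of the line ~ P^1_{F_q}: irreducible (nonconstant) binary
   forms h over F_q (up to scalars). *)
Definition irreducible_mpoly (k : nat) (h : {mpoly F[k]}) : Prop :=
  (1 < msize h)%N /\
  forall a b : {mpoly F[k]}, h = a * b -> (msize a <= 1)%N \/ (msize b <= 1)%N.

(* The line meets C_f with multiplicity >= 2 at the closed point h: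
   h^2 divides the restriction (this includes the case where the line is
   contained in C_f, i.e. restriction = 0). *)
Definition mult_ge2_at (g h : {mpoly F[2]}) : Prop :=
  exists k : {mpoly F[2]}, g = h ^+ 2 * k.

(* A line (the F_q-span of two linearly independent P, Q in F^3) is transverse
   to C_f iff the intersection has multiplicity 1 at every closed point. *)
Definition transverse (f : {mpoly F[3]}) (P Q : 'rV[F]_3) : Prop :=
  ~ exists h : {mpoly F[2]}, irreducible_mpoly h /\ mult_ge2_at (restrict f P Q) h.

Definition transverse_free (f : {mpoly F[3]}) : Prop :=
  forall P Q : 'rV[F]_3, row_free (col_mx P Q) -> ~ transverse f P Q.

End Defs.

From Stdlib Require Import Rdefinitions Raxioms RIneq Rfunctions Rseries.

Definition omega_ratio (F : finFieldType) (d : nat) : R :=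
  Rdiv (INR #|[set c : {ffun mon d -> F} | asbool (transverse_free (@poly_of_coefs F d c))]|)
       (INR #|{ffun mon d -> F}|).

Definition omega_seq (F : finFieldType) : nat -> R :=
  fun n => omega_ratio F n.+1.

Definition omega_bound (q : nat) : R :=
  Rmult (INR 2) (Rinv (pow (INR q) (q + 1))).

(* Main.v *)
Require Import Defs.
From Stdlib Require Classical_Prop.
From HB Require Import structures.
From mathcomp Require Import all_boot all_order all_algebra all_field.
From mathcomp Require Import mpoly zify ring.

Set Implicit Arguments.
Unset Strict Implicit.
Unset Printing Implicit Defensive.

Import GRing.Theory.
Local Open Scope ring_scope.

(** Tangency of the line PQ to C_f is the existence of a square factor of f(X P + Q) or of f(X Q + P).

    The density exists by a sieve. Keep only the square factors of degree at most r. Up to an error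
    O(q^-r), uniform in d, this does not change the proportion of transverse-free forms of degree d. The
    truncated condition depends only on finitely many residues of f, and multiplication by a form of degree
    e that does not vanish at any closed point of degree at most r embeds the residues of R_d into those of
    R_(d+e) and preserves the condition; such forms exist for all large e, so the truncated proportion is
    eventually constant.

    For the bound, let l0 be the line z = 0. Since l0 is tangent with probability at most
    1/q + 1/q^2 - 1/q^3, the forms that do not vanish at some rational point P of l0 contribute at most
    q^-q (1/q + 1/q^2 - 1/q^3): each of the q other lines through P is tangent with conditional
    probability at most 1/q, independently. The forms vanishing at all q + 1 rational points of l0 have
    density q^-(q+1), and for them one further line through a point of l0 is tangent with probability at
    most 2/q - 1/q^2. The sum is q^-(q+1) (1 + 3/q - 2/q^2) <= 2 q^-(q+1). *)

(** * Square factors of univariate polynomials *)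

Section Counting.

Lemma card_le_rel (T U : finType) (S : {set T}) (rel : T -> U -> Prop) :
  (forall x, x \in S -> exists u, rel x u) ->
  (forall x y u, x \in S -> y \in S -> rel x u -> rel y u -> x = y) ->
  (#|S| <= #|U|)%N.
Proof.
move=> ex_rel inj_rel.
have [f fP] : exists f : {x | x \in S} -> U, forall x, rel (val x) (f x).
  exact: (fin_all_exists (fun x => ex_rel (val x) (valP x))).
rewrite -(card_sig (mem S)); apply: (@leq_card _ _ f) => x y eq_f.
apply: val_inj; apply: (inj_rel _ _ (f x) (valP x) (valP y) (fP x)).
by rewrite eq_f.
Qed.

Lemma card_le1_inj (T : finType) (S : {set T}) :
  (forall x y, x \in S -> y \in S -> x = y) -> (#|S| <= 1)%N.
Proof. by move=> eqS; apply/card_le1_eqP => x y xS yS; apply: eqS. Qed.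

(** Double counting of the pairs [(f, h)] with [sh h f] in [A]: each [h] contributes [#|A|], since
    [sh h] is a permutation, and only [f] in [C] contribute, at most [K] each. In effect the
    conditional probability of [A] given [C] is at most [K / #|H|]. *)
Lemma card_shift_le (V H : finType) (sh : H -> V -> V) (A C : {set V}) (K : nat) :
  (forall h, injective (sh h)) ->
  (forall f h, sh h f \in A -> f \in C) ->
  (forall f, f \in C -> (#|[set h | sh h f \in A]| <= K)%N) ->
  (#|A| * #|H| <= #|C| * K)%N.
Proof.
move=> inj_sh AC boundK.
have -> : (#|A| * #|H| = \sum_(f in C) #|[set h | sh h f \in A]|)%N.
  transitivity (\sum_f #|[set h | sh h f \in A]|)%N.
    transitivity (\sum_(h : H) \sum_(f : V) (sh h f \in A))%N.
      transitivity (\sum_(h : H) #|A|)%N.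
        by rewrite sum_nat_const mulnC.
      apply: eq_bigr => h _; rewrite -sum1_card big_mkcond /=.
      rewrite (reindex_inj (inj_sh h)) /=.
      by apply: eq_bigr => f _; case: ifP.
    rewrite exchange_big; apply: eq_bigr => f _.
    rewrite -sum1_card [RHS]big_mkcond; apply: eq_bigr => h _.
    by rewrite inE; case: ifP.
  rewrite [RHS]big_mkcond; apply: eq_bigr => f _; case: ifPn => // nCf.
  by apply/eqP; rewrite cards_eq0; apply/eqP/setP => h; rewrite !inE;
     apply/negbTE; apply: contra nCf; apply: AC.
rewrite -sum_nat_const; apply: leq_sum => f; exact: boundK.
Qed.

End Counting.

Section Squares.
Variable F : finFieldType.
Implicit Types (p g a b : {poly F}) (r m n : nat).

(** Row vectors code the candidate square roots of degree at most [r], so the property is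
    decidable. *)
Definition has_sq r g : bool :=
  [exists v : 'rV[F]_(r.+1), (1 < size (rVpoly v))%N && (rVpoly v ^+ 2 %| g)].

Lemma has_sqP r g :
  reflect (exists p, (1 < size p <= r.+1)%N /\ (p ^+ 2 %| g)) (has_sq r g).
Proof.
apply: (iffP existsP) => [[v /andP[sz_v dv]]|[p [/andP[sz1 sz2] dv]]].
  by exists (rVpoly v); rewrite sz_v size_poly.
by exists (poly_rV p); rewrite poly_rV_K // sz1.
Qed.

Lemma has_sq_le r r' g : (r <= r')%N -> has_sq r g -> has_sq r' g.
Proof.
move=> le_r /has_sqP[p [/andP[sz1 sz2] dv]]; apply/has_sqP; exists p.
by rewrite sz1 (leq_trans sz2).
Qed.

Lemma ltn_size_sqrp p g : g != 0 -> (p ^+ 2 %| g) ->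
  ((size p).-1 * 2 < size g)%N.
Proof.
move=> g0 dv; have p20 : p ^+ 2 != 0 by apply: contraNneq g0 => p0; rewrite p0 dvd0p in dv.
have := dvdp_leq g0 dv; have := size_exp p 2.
have : (0 < size (p ^+ 2))%N by rewrite size_poly_gt0.
by case: (size (p ^+ 2)) => //= k _ <-.
Qed.

Lemma leq_size_sq p g m : g != 0 -> (p ^+ 2 %| g) -> (size g <= m.+1)%N ->
  (size p <= m.+1)%N.
Proof.
move=> g0 /(ltn_size_sqrp g0) + sz; move: sz.
move: (size p) (size g) => [|s] t /=; lia.
Qed.

Lemma monic_scale_dvd p g : p != 0 -> exists a,
  [/\ a \is monic, size a = size p & (p ^+ 2 %| g) = (a ^+ 2 %| g)].
Proof.
move=> p0; have lp : lead_coef p != 0 by rewrite lead_coef_eq0.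
have lpV : (lead_coef p)^-1 != 0 by rewrite invr_eq0.
exists ((lead_coef p)^-1 *: p); split; first by rewrite monicE lead_coefZ mulVf.
  by rewrite size_scale.
by rewrite exprZn dvdpZl // expf_neq0.
Qed.

(** Take [a] monic of maximal degree with [a ^+ 2 %| g]; a square factor left in the quotient would
    enlarge it. *)
Lemma square_decomposition m g : g \is monic -> (size g <= m.+1)%N ->
  exists a b, [/\ a \is monic, b \is monic, ~~ has_sq m b, g = a ^+ 2 * b &
                  has_sq m g -> (1 < size a)%N].
Proof.
move=> mon_g sz_g; have g0 := monic_neq0 mon_g.
pose P k := [exists v : 'rV[F]_(m.+1), [&& rVpoly v \is monic, size (rVpoly v) == k
   & (rVpoly v ^+ 2 %| g)]].
have exP : exists k, P k.
  exists 1%N; apply/existsP; exists (poly_rV 1); rewrite poly_rV_K ?size_poly1 //.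
  by rewrite monic1 eqxx expr1n dvd1p.
have bdP k : P k -> (k <= m.+1)%N.
  by move=> /existsP[v /and3P[_ /eqP<- _]]; rewrite size_poly.
case: (ex_maxnP exP bdP) => k /existsP[v]; set a : {poly F} := rVpoly v.
move=> /and3P[mon_a /eqP sz_a dv] maxk.
have a0 := monic_neq0 mon_a.
have eg : g = a ^+ 2 * (g %/ a ^+ 2) by rewrite mulrC divpK.
exists a, (g %/ a ^+ 2); split=> //.
- by move: mon_g; rewrite {1}eg monicMl // monic_exp.
- apply/negP => /has_sqP[p [/andP[szp _] dvp]].
  have p0 : p != 0 by rewrite -size_poly_gt0 ltnW.
  have [c [mon_c sz_c ec]] := monic_scale_dvd (g %/ a ^+ 2) p0.
  have c0 := monic_neq0 mon_c.
  have dvac : (a * c) ^+ 2 %| g.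
    by rewrite exprMn eg dvdp_mul // -ec.
  have szac : (size (a * c)%R <= m.+1)%N.
    exact: leq_size_sq g0 dvac sz_g.
  have /maxk : P (size (a * c)).
    by apply/existsP; exists (poly_rV (a * c)); rewrite poly_rV_K // monicMl // mon_c eqxx.
  by rewrite size_mul // -sz_a sz_c; move: szp; case: (size p) => [|[|k']] // _;
     rewrite addnS -addSnnS leqNgt ltnS leq_addr.
- move=> /has_sqP[p [/andP[szp szp2] dvp]].
  have p0 : p != 0 by rewrite -size_poly_gt0 ltnW.
  have [c [mon_c sz_c ec]] := monic_scale_dvd g p0.
  have /maxk : P (size c).
    by apply/existsP; exists (poly_rV c); rewrite poly_rV_K ?sz_c // mon_c eqxx /= -ec.
  by rewrite sz_a sz_c; apply: leq_trans.
Qed.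

(** After division by the gcd of [a] and [a'] the cofactors [u], [w] are coprime, so [u ^+ 2]
    divides [b'], which forces [u] to be constant. *)
Lemma square_decomposition_dvd m a b a' b' :
  a \is monic -> b != 0 -> ~~ has_sq m b' -> (size b' <= m.+1)%N -> b' != 0 ->
  a' != 0 -> a ^+ 2 * b = a' ^+ 2 * b' -> a %| a'.
Proof.
move=> mon_a b0 sqf sz_b' b'0 a'0 eq_ab.
have a0 := monic_neq0 mon_a.
set c := gcdp a a'; have c0 : c != 0 by rewrite gcdp_eq0 (negPf a0).
have ea : a = (a %/ c) * c by rewrite divpK // dvdp_gcdl.
have ea' : a' = (a' %/ c) * c by rewrite divpK // dvdp_gcdr.
set u := a %/ c in ea; set w := a' %/ c in ea'.
have co : coprimep u w by rewrite coprimep_div_gcd // a0.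
have : u ^+ 2 %| b'.
  have : u ^+ 2 * b = w ^+ 2 * b'.
    apply: (mulIf (expf_neq0 2 c0)).
    have -> : u ^+ 2 * b * c ^+ 2 = a ^+ 2 * b by rewrite ea; ring.
    by rewrite eq_ab {1}ea'; ring.
  move=> e; have : u ^+ 2 %| w ^+ 2 * b' by rewrite -e dvdp_mulr.
  by rewrite Gauss_dvdpr // coprimep_expl // coprimep_expr.
move=> dvu; have u0 : u != 0 by apply: contraNneq a0 => u0; rewrite ea u0 mul0r.
have su : (size u <= 1)%N.
  rewrite leqNgt; apply: contra sqf => szu; apply/has_sqP; exists u; split=> //.
  by rewrite szu (leq_size_sq b'0 dvu).
rewrite ea (eqp_dvdl _ (_ : u * c %= c)) ?dvdp_gcdr //.
have /size_poly1P[k k0 ->] : size u == 1%N.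
  by rewrite eqn_leq su size_poly_gt0.
by rewrite mul_polyC eqp_scale.
Qed.

Lemma square_decomposition_uniq m a b a' b' :
  a \is monic -> a' \is monic -> b \is monic -> b' \is monic ->
  ~~ has_sq m b -> ~~ has_sq m b' ->
  (size b <= m.+1)%N -> (size b' <= m.+1)%N ->
  a ^+ 2 * b = a' ^+ 2 * b' -> a = a' /\ b = b'.
Proof.
move=> ma ma' mb mb' sb sb' zb zb' e.
have [a0 a'0 b0 b'0] :
  [/\ a != 0, a' != 0, b != 0 & b' != 0] by rewrite !monic_neq0.
have ea : a = a'.
  apply/eqP; rewrite -eqp_monic // /eqp.
  rewrite (square_decomposition_dvd ma b0 sb' zb' b'0 a'0 e).
  by rewrite (square_decomposition_dvd ma' b'0 sb zb b0 a0 (esym e)).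
split=> //; apply: (mulfI (expf_neq0 2 a0)); rewrite e ea //.
Qed.

Lemma size_monic_Xn_rV m (v : 'rV[F]_m) :
  ('X^m + rVpoly v \is monic) /\ size ('X^m + rVpoly v) = m.+1.
Proof.
have h : (size (rVpoly v) < size ('X^m : {poly F}))%N.
  by rewrite size_polyXn ltnS size_poly.
by rewrite monicE lead_coefDl // lead_coefXn eqxx size_polyDl // size_polyXn.
Qed.

(* A non-squarefree g = a^2 b with b squarefree and a = a1 X + a0 nonconstant
   is determined by a0 and the monic polynomial a1^2 b of degree m - 2. *)
Lemma card_monic_has_sq r m :
  (#|[set v : 'rV[F]_m | has_sq r ('X^m + rVpoly v)%R]| * #|F| <= #|F| ^ m)%N.
Proof.
set S := [set v | _].
have sqm (v : 'rV_m) : v \in S -> has_sq m ('X^m + rVpoly v).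
  rewrite inE => /has_sqP[p [/andP[sz _] dv]]; apply/has_sqP; exists p.
  split=> //; rewrite sz /=; have [mon szg] := size_monic_Xn_rV v.
  by apply: leq_size_sq (monic_neq0 mon) dv _; rewrite szg.
have [lt_m|] := ltnP m 2.
  suff -> : S = set0 by rewrite cards0.
  apply/eqP; rewrite -subset0; apply/subsetP => v /sqm /has_sqP[p [/andP[sz _] dv]].
  have [mon szg] := size_monic_Xn_rV v.
  have := ltn_size_sqrp (monic_neq0 mon) dv; rewrite szg.
  by move: sz; case: (size p) => [|[|k]] //= _; lia.
case: m S sqm => // -[//|m] S sqm _.
(* The degree is now [m.+2]; a code consists of [a0] and the [m] coefficients of [a1 ^+ 2 * b] below
   its leading term. *)
have: (#|S| <= #|{: F * 'rV[F]_m}|)%N; last first.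
  rewrite card_prod card_mx mul1n => le_S.
  by rewrite !expnS mulnA mulnAC leq_mul2r [X in _ || X](leq_trans le_S) ?orbT // mulnC.
pose rel (v : 'rV[F]_m.+2) (u : F * 'rV[F]_m) := exists a b,
  [/\ a \is monic, b \is monic, ~~ has_sq m.+2 b,
    'X^(m.+2) + rVpoly v = (a * 'X + u.1%:P) ^+ 2 * b &
     a ^+ 2 * b = 'X^m + rVpoly u.2].
apply: (@card_le_rel _ _ S rel).
  move=> v vS; have [mon szg] := size_monic_Xn_rV v.
  have [|a [b [ma mb sb eg /(_ (sqm _ vS)) sza]]] := @square_decomposition m.+2 _ mon.
    by rewrite szg.
  pose a1 := a %/ 'X; pose a0 := a.[0].
  have ea : a = a1 * 'X + a0%:P.
    by rewrite [LHS](divp_eq a 'X) -[X in a %% X]subr0 -polyC0 modp_XsubC.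
  have a10 : a1 != 0.
    by apply: contraTneq sza => a10; rewrite ea a10 mul0r add0r -leqNgt size_polyC_leq1.
  have ma1 : a1 \is monic.
    move: ma; rewrite ea !monicE lead_coefDl ?lead_coefMX //.
    by rewrite size_mulX // ltnS (leq_trans (size_polyC_leq1 _)) // size_poly_gt0.
  exists (a0, poly_rV (a1 ^+ 2 * b - 'X^m)); exists a1, b; split=> //=.
    by rewrite -ea.
  have sz1 : size (a1 ^+ 2 * b) = m.+1.
    have sz_a : size a = (size a1).+1.
      rewrite ea size_polyDl size_mulX // ltnS.
      by rewrite (leq_trans (size_polyC_leq1 _)) // size_poly_gt0.
    have := szg; rewrite eg !size_monicM ?monic_exp ?monic_neq0 //.
    have := size_exp a 2; have := size_exp a1 2.
    have : (0 < size (a ^+ 2)%R)%N by rewrite size_poly_gt0 expf_neq0 ?monic_neq0.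
    have : (0 < size (a1 ^+ 2)%R)%N by rewrite size_poly_gt0 expf_neq0 ?monic_neq0.
    have : (0 < size a1)%N by rewrite size_poly_gt0.
    have : (0 < size b)%N by rewrite size_poly_gt0 monic_neq0.
    rewrite sz_a; move: (size (a ^+ 2)) (size (a1 ^+ 2)) (size b) (size a1).
    by move=> x y z t; lia.
  suff sz2 : (size (a1 ^+ 2 * b - 'X^m)%R <= m)%N by rewrite (poly_rV_K sz2) addrC subrK.
  apply/leq_sizeP => j; rewrite leq_eqVlt => /orP[/eqP<-|ltj].
    have: a1 ^+ 2 * b \is monic by rewrite monicMl ?monic_exp.
    rewrite monicE lead_coefE sz1 coefB coefXn eqxx => /eqP-> /=; exact: subrr.
  by rewrite coefB coefXn gtn_eqF // subr0 nth_default // sz1.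
move=> v v' [a0 w] vS v'S [a [b [ma mb sb eg ew]]] [a' [b' [ma' mb' sb' eg' ew']]].
have bound (c e : {poly F}) : c \is monic -> e \is monic ->
    c ^+ 2 * e = 'X^m + rVpoly w -> (size e <= m.+3)%N.
  move=> mc me h; have := (size_monic_Xn_rV w).2; rewrite -h.
  rewrite size_monicM ?monic_exp ?monic_neq0 //.
  have : (0 < size (c ^+ 2)%R)%N by rewrite size_poly_gt0 expf_neq0 ?monic_neq0.
  by move: (size (c ^+ 2)) (size e) => x y; lia.
have [ea eb] := square_decomposition_uniq ma ma' mb mb' sb sb' (bound _ _ ma mb ew)
  (bound _ _ ma' mb' ew') (etrans ew (esym ew')).
apply: (can_inj (@rVpolyK F m.+2)); apply: (addrI ('X^(m.+2))).
by rewrite eg eg' ea eb.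
Qed.

(** A common multiple of all squares of nonzero polynomials of degree at most [r]: [has_sq r]
    depends only on the residue modulo it. *)
Definition sq_modulus r : {poly F} :=
  \prod_(v : 'rV[F]_(r.+1) | v != 0) rVpoly v ^+ 2.

Definition sq_deg r := (size (sq_modulus r)).-1.

Lemma sq_modulus_neq0 r : sq_modulus r != 0.
Proof.
apply/prodf_neq0 => v v0; apply: expf_neq0; apply: contra v0 => /eqP h.
by rewrite -(rVpolyK v) h linear0.
Qed.

Lemma dvdp_sq_modulus r p : p != 0 -> (size p <= r.+1)%N -> p ^+ 2 %| sq_modulus r.
Proof.
move=> p0 sz; have v0 : poly_rV p != 0 :> 'rV_(r.+1).
  by apply: contra p0 => /eqP h; rewrite -(poly_rV_K sz) h linear0.
by rewrite /sq_modulus (bigD1 (poly_rV p)) //= poly_rV_K // dvdp_mulr.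
Qed.

Lemma has_sq_mod r g : has_sq r (g %% sq_modulus r) = has_sq r g.
Proof.
apply/has_sqP/has_sqP => -[p [sz dv]]; exists p; split=> //.
all: have p0 : p != 0 by rewrite -size_poly_gt0; lia.
all: have dvM : p ^+ 2 %| sq_modulus r by rewrite dvdp_sq_modulus //; lia.
  by rewrite (divp_eq g (sq_modulus r)) dvdp_add // dvdp_mull.
by rewrite -(dvdp_addr _ (dvdp_mull (g %/ sq_modulus r) dvM)) -divp_eq.
Qed.

Lemma size_mod_sq r g : (size (g %% sq_modulus r)%R <= sq_deg r)%N.
Proof.
have := ltn_modpN0 g (sq_modulus_neq0 r).
by rewrite /sq_deg; case: (size (sq_modulus r)).
Qed.

(** Vectors of length [sq_deg r] represent each residue class once, and translation by [g] permutes
    the classes. *)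
Lemma card_has_sq_mod r g :
  #|[set v : 'rV[F]_(sq_deg r) | has_sq r (g + rVpoly v)%R]| =
  #|[set v : 'rV[F]_(sq_deg r) | has_sq r (rVpoly v)]|.
Proof.
set m := sq_deg r; pose w : 'rV[F]_m := poly_rV (g %% sq_modulus r).
rewrite -(card_imset _ (addrI w)); apply: eq_card => v; rewrite inE.
have key (u : 'rV[F]_m) : has_sq r (rVpoly (w + u)) = has_sq r (g + rVpoly u).
  rewrite linearD /= poly_rV_K ?size_mod_sq // -[RHS]has_sq_mod modpD.
  by rewrite -[LHS]has_sq_mod modpD modp_id.
apply/imsetP/idP => [[u ] | hv].
  by rewrite inE => hu ->; rewrite key.
by exists (v - w); rewrite ?inE -?key addrC subrK // linearB.
Qed.

(** By translation invariance [g] may be replaced by ['X^(sq_deg r)], which reduces the count to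
    monic polynomials. *)
Lemma card_has_sq_shift r g :
  (#|[set v : 'rV[F]_(sq_deg r) | has_sq r (g + rVpoly v)%R]| * #|F| <= #|F| ^ sq_deg r)%N.
Proof. by rewrite card_has_sq_mod -(card_has_sq_mod r 'X^(sq_deg r)) card_monic_has_sq. Qed.

End Squares.

(** * Large square factors, and forms without small zeros *)

Section Tail.
Variable F : finFieldType.

Lemma card_finField_gt1 : (1 < #|F|)%N.
Proof. exact: finNzRing_gt1. Qed.

Lemma sum_pow_le q n : (1 < q)%N -> (\sum_(j < n) q ^ j.+1 <= q ^ n.+1)%N.
Proof.
move=> q1; elim: n => [|n IHn]; first by rewrite big_ord0.
rewrite big_ord_recr /=; apply: (leq_trans (leq_add IHn (leqnn _))).
by rewrite addnn -mul2n [leqRHS]expnS leq_mul2r q1 orbT.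
Qed.

(** The code is the monic square root together with the quotient: [e] and [d.+1 - e.*2] free
    coefficients. *)
Lemma card_sq_of_degree d e : (e.*2 <= d)%N ->
  (#|[set v : 'rV[F]_(d.+1) | (v != 0)%R && [exists u : 'rV[F]_e,
      (('X^e + rVpoly u) ^+ 2 %| rVpoly v)%R]]| <= #|F| ^ (d.+1 - e))%N.
Proof.
move=> le_ed; set S := [set v | _].
have -> : (#|F| ^ (d.+1 - e) = #|{: 'rV[F]_e * 'rV[F]_(d.+1 - e.*2)}|)%N.
  by rewrite card_prod !card_mx !mul1n -expnD; congr (_ ^ _)%N; lia.
apply: (@card_le_rel _ _ S (fun v u =>
  rVpoly v = ('X^e + rVpoly u.1) ^+ 2 * rVpoly u.2)).
  move=> v; rewrite inE => /andP[v0 /existsP[u dv]].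
  set p := 'X^e + rVpoly u in dv *.
  have [mon_p sz_p] := size_monic_Xn_rV u; rewrite -/p in mon_p sz_p.
  exists (u, poly_rV (rVpoly v %/ p ^+ 2)) => /=; rewrite -/p.
  rewrite poly_rV_K; first by rewrite mulrC divpK.
  rewrite size_divp ?expf_neq0 ?monic_neq0 //.
  have := size_exp p 2; rewrite sz_p /=.
  have := size_poly d.+1 (fun k => if insub k is Some i then v 0 i else 0).
  rewrite -/(rVpoly v).
  by move: (size (p ^+ 2)) (size (rVpoly v)) => x y; lia.
by move=> v v' u _ _ e1 e2; apply: (can_inj (@rVpolyK F d.+1)); rewrite e1 e2.
Qed.

(** A square factor of degree at most [d] but none of degree at most [r] has a monic root of some
    degree [e > r]; the counts [#|F| ^ (d.+1 - e)] form a geometric sum. *)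
Lemma card_has_sq_tail r d : (0 < r)%N ->
  (#|[set v : 'rV[F]_(d.+1) | has_sq d (rVpoly v) && ~~ has_sq r (rVpoly v)]|
     * #|F| ^ r <= #|F| ^ d.+1)%N.
Proof.
move=> r0; set S := [set v | _].
pose S_ e := [set v : 'rV[F]_(d.+1) | (v != 0)%R && [exists u : 'rV[F]_e,
      (('X^e + rVpoly u) ^+ 2 %| rVpoly v)%R]].
have inS v : v \in S -> exists2 e, (r < e)%N && (e.*2 <= d)%N & v \in S_ e.
  rewrite inE => /andP[/has_sqP[p [/andP[szp _] dv]] nsq].
  have v0 : rVpoly v != 0.
    (* The zero polynomial is divisible by ['X ^+ 2], an allowed square because [0 < r], so it is
       not in [S]. *)
    apply: contraNneq nsq => ->; apply/has_sqP; exists 'X.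
    by rewrite size_polyX dvdp0 !ltnS.
  have p0 : p != 0 by rewrite -size_poly_gt0 ltnW.
  have [a [mon_a sz_a ea]] := monic_scale_dvd (rVpoly v) p0.
  have lt_r : (r.+1 < size p)%N.
    rewrite ltnNge; apply: contra nsq => le_p; apply/has_sqP; exists p.
    by rewrite szp le_p.
  exists (size p).-1.
    have := ltn_size_sqrp v0 dv; have := size_poly d.+1 (fun k => if insub k is Some i then v 0 i else 0).
    rewrite -/(rVpoly v).
    by move: lt_r; move: (size p) (size (rVpoly v)) => x y; lia.
  rewrite inE; apply/andP; split.
    by apply: contra v0 => /eqP->; rewrite linear0.
  apply/existsP; exists (poly_rV (a - 'X^((size p).-1))).
  rewrite poly_rV_K ?[_ + (_ - _)]addrC ?subrK -?ea //.
  have ez : size a = (size p).-1.+1 by rewrite sz_a prednK // ltnW.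
  apply/leq_sizeP => j; rewrite leq_eqVlt => /orP[/eqP<-|ltj].
    move: mon_a; rewrite monicE lead_coefE ez coefB coefXn eqxx => /eqP-> /=; exact: subrr.
  by rewrite coefB coefXn gtn_eqF // subr0 nth_default // ez.
have [le_dr|lt_rd] := leqP d r.
  suff -> : S = set0 by rewrite cards0.
  apply/eqP; rewrite -subset0; apply/subsetP => v /inS[e]; lia.
have le1 : (#|S| <= \sum_(r.+1 <= e < d.+1) #|F| ^ (d.+1 - e))%N.
  apply: (@leq_trans (\sum_(r.+1 <= e < d.+1 | (e.*2 <= d)%N) #|S_ e|)%N); last first.
    rewrite big_mkcond /=; apply: leq_sum => e _; case: ifP => // le_e.
    exact: card_sq_of_degree.
  have -> : (\sum_(r.+1 <= e < d.+1 | (e.*2 <= d)%N) #|S_ e|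
     = \sum_(v : 'rV[F]_d.+1) \sum_(r.+1 <= e < d.+1 | (e.*2 <= d)%N) (v \in S_ e))%N.
    rewrite exchange_big; apply: eq_bigr => e _.
    by rewrite -sum1_card big_mkcond; apply: eq_bigr => v _; case: ifP.
  rewrite -sum1_card big_mkcond; apply: leq_sum => v _; case: ifP => // /inS[e /andP[re ed] vS].
  rewrite (big_rem e) /=; last by rewrite mem_index_iota; lia.
  by rewrite ed vS.
apply: (leq_trans (leq_mul le1 (leqnn _))).
have -> : (\sum_(r.+1 <= e < d.+1) #|F| ^ (d.+1 - e) = \sum_(j < d - r) #|F| ^ j.+1)%N.
  rewrite big_nat_rev /= -{1}[r.+1]add0n big_addn big_mkord.
  have -> : (d.+1 - r.+1 = d - r)%N by lia.
  apply: eq_bigr => j _; have := ltn_ord j; set k := nat_of_ord j => lt_k.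
  by congr (_ ^ _)%N; lia.
have h := sum_pow_le (d - r) card_finField_gt1.
apply: (leq_trans (leq_mul h (leqnn _))); rewrite -expnD leq_exp2l ?card_finField_gt1 //; lia.
Qed.

Lemma card_rV_translate n (P : pred {poly F}) (g : {poly F}) : (size g <= n)%N ->
  #|[set v : 'rV[F]_n | P (g + rVpoly v)]| = #|[set v : 'rV[F]_n | P (rVpoly v)]|.
Proof.
move=> szg; pose w : 'rV[F]_n := poly_rV g.
rewrite -(card_imset _ (addrI w)); apply: eq_card => v; rewrite inE.
have key (u : 'rV[F]_n) : rVpoly (w + u) = g + rVpoly u.
  by rewrite linearD /= poly_rV_K.
apply/imsetP/idP => [[u ] | hv].
  by rewrite inE => hu ->; rewrite key.
by exists (v - w); rewrite ?inE -?key addrC subrK // linearB.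
Qed.

End Tail.

(** * A multiplier prime to all irreducibles of small degree *)

Section Multiplier.
Variable F : finFieldType.
Implicit Types (p u g : {poly F}) (r : nat).

Lemma irreducible_coprimep p u : irreducible_poly p -> ~~ (p %| u) -> coprimep p u.
Proof.
move=> irr ndv; rewrite /coprimep; apply: contraR ndv => sz.
have := irr.2 _ sz (dvdp_gcdl p u) => /eqp_dvdl <-; exact: dvdp_gcdr.
Qed.

Lemma irreducible_dvdpM p u g : irreducible_poly p ->
  (p %| u * g) = (p %| u) || (p %| g).
Proof.
move=> irr; have [dv|ndv] := boolP (p %| u); first by rewrite dvdp_mulr.
by rewrite Gauss_dvdpr // irreducible_coprimep.
Qed.

Lemma irreducible_dvdpX p u n : irreducible_poly p -> p %| u ^+ n -> p %| u.
Proof.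
move=> irr; elim: n => [|n IHn].
  by rewrite expr0 dvdp1; case: irr => + _; case: (size p) => [|[|]].
by rewrite exprS irreducible_dvdpM // => /orP[|/IHn].
Qed.

(** A nonconstant divisor of minimal size is irreducible. *)
Lemma irreducible_factor g : (1 < size g)%N ->
  exists2 p, irreducible_poly p & p %| g.
Proof.
move=> szg; have g0 : g != 0 by rewrite -size_poly_gt0 ltnW.
pose P k := [exists v : 'rV[F]_(size g), [&& size (rVpoly v) == k, (1 < k)%N
   & (rVpoly v %| g)]].
have exP : exists k, P k.
  exists (size g); apply/existsP; exists (poly_rV g).
  by rewrite poly_rV_K // eqxx szg dvdpp.
case: (ex_minnP exP) => k /existsP[v]; set p : {poly F} := rVpoly v.
move=> /and3P[/eqP szp k1 dv] mink; exists p => //; split; first by rewrite szp.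
move=> c szc dvc.
have p0 : p != 0 by rewrite -size_poly_gt0 szp ltnW.
have c0 : c != 0 by apply: contraTneq dvc => ->; rewrite dvd0p.
have dvcg := dvdp_trans dvc dv.
rewrite -dvdp_size_eqp // eqn_leq dvdp_leq //= szp mink //.
apply/existsP; exists (poly_rV c); rewrite poly_rV_K ?dvdp_leq // eqxx dvcg andbT /=.
have : (0 < size c)%N by rewrite size_poly_gt0.
by move: szc; case: (size c) => [|[|]].
Qed.

Definition unit_exponent r := (#|F| ^ r)`!.

(** Among the powers [u ^+ i] with [i <= #|F| ^ r] two agree modulo [p], as there are at most
    [#|F| ^ r] residues. The difference of their exponents divides the factorial, which therefore
    serves all such [p] and [u] at once. *)
Lemma irreducible_unit_exponent r p u :
  irreducible_poly p -> (size p <= r.+1)%N -> ~~ (p %| u) ->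
  p %| u ^+ unit_exponent r - 1.
Proof.
move=> irr szp ndv; have p0 := irredp_neq0 irr.
pose f (i : 'I_((#|F| ^ r).+1)) : 'rV[F]_r := poly_rV (u ^+ i %% p).
have : ~~ injectiveb f.
  apply/negP => /injectiveP /leq_card.
  by rewrite card_ord card_mx mul1n ltnn.
case/injectivePn => i [j neq_ij eq_f].
wlog lt_ij : i j neq_ij eq_f / (i < j)%N.
  move=> wl; have [lt|lt|eq] := ltngtP i j; first exact: wl eq_f lt.
    by apply: wl lt; rewrite 1?eq_sym.
  by rewrite (val_inj eq) eqxx in neq_ij.
have szm (g : {poly F}) : (size (g %% p)%R <= r)%N.
  have := ltn_modpN0 g p0; move: szp.
  by move: (size p) (size (g %% p)) => x y; lia.
have eq_mod : u ^+ i %% p = u ^+ j %% p.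
  rewrite -(poly_rV_K (szm (u ^+ i))) -(poly_rV_K (szm (u ^+ j))).
  by rewrite -[poly_rV (u ^+ i %% p)]/(f i) eq_f.
have dv : p %| u ^+ i * (u ^+ (j - i) - 1).
  rewrite mulrBr mulr1 -exprD subnKC; last exact: ltnW.
  by apply/modp_eq0P; rewrite modpD modpN eq_mod subrr.
have {dv} dv : p %| u ^+ (j - i) - 1.
  move: dv; rewrite irreducible_dvdpM // => /orP[/(irreducible_dvdpX irr)|//].
  by rewrite (negPf ndv).
have /dvdnP[k ->] : (j - i %| unit_exponent r)%N.
  by apply: dvdn_fact; have := ltn_ord j; lia.
by rewrite mulnC exprM subrX1 dvdp_mulr.
Qed.

(** Homogeneous of degree [e] in [x], [y], [z] once [N.*2 <= e]. It is defined over any commutative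
    ring so that restriction to a line carries it to the same expression in the restricted
    coordinates. *)
Definition multiplier (R : comNzRingType) (N e : nat) (x y z : R) : R :=
  x ^+ e + y ^+ (e - N) * (y ^+ N - x ^+ N)
  + z ^+ (e - N.*2) * (z ^+ N - x ^+ N) * (z ^+ N - y ^+ N).

Lemma rmorph_multiplier (R S : comNzRingType) (phi : {rmorphism R -> S}) N e x y z :
  phi (multiplier N e x y z) = multiplier N e (phi x) (phi y) (phi z).
Proof. by rewrite /multiplier !rmorphD !rmorphM !rmorphB !rmorphXn. Qed.

(* [N] is chosen so that [u ^+ N] is [0] or [1] modulo [p]; thus [multiplier N e x y z] is congruent to
   [x ^+ e], [y ^+ e] or [z ^+ e] according to the first of [x], [y], [z] that is nonzero modulo [p]. *)
Lemma irreducible_ndvd_multiplier r e p x y z :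
  irreducible_poly p -> (size p <= r.+1)%N -> ((unit_exponent r).*2 < e)%N ->
  ~~ [&& p %| x, p %| y & p %| z] ->
  ~~ (p %| multiplier (unit_exponent r) e x y z).
Proof.
move=> irr szp; set N := unit_exponent r => lt_e.
have N0 : (0 < N)%N by rewrite fact_gt0.
have unitN u : ~~ (p %| u) -> p %| u ^+ N - 1 by exact: irreducible_unit_exponent.
have diff u w k : (0 < k)%N -> ~~ (p %| u) -> p %| w ^+ k * (w ^+ N - u ^+ N).
  move=> k0 pu; have [pw|pw] := boolP (p %| w).
    by rewrite dvdp_mulr // -(prednK k0) exprS dvdp_mulr.
  rewrite dvdp_mull // (_ : _ - _ = (w ^+ N - 1) - (u ^+ N - 1)); last by ring.
  by rewrite dvdp_sub // unitN.
have dvX u k : (0 < k)%N -> p %| u -> p %| u ^+ k.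
  by move=> k0 pu; rewrite -(prednK k0) exprS dvdp_mulr.
rewrite /multiplier; have [px|px] := boolP (p %| x); last first.
  move=> _; rewrite addrAC dvdp_addl; last by apply: diff => //; lia.
  rewrite dvdp_addl; last by rewrite dvdp_mulr //; apply: diff => //; lia.
  by apply: contra px; apply: irreducible_dvdpX.
have [py|py] := boolP (p %| y) => /=; last first.
  move=> _; rewrite dvdp_addl; last first.
    by rewrite mulrAC dvdp_mulr //; apply: diff => //; lia.
  rewrite dvdp_addr; last by apply: dvX px; lia.
  rewrite irreducible_dvdpM // negb_or (dvdp_subl _ (dvX _ _ N0 px)).
  by apply/andP; split; apply: contra py; apply: irreducible_dvdpX.
move=> pz; rewrite -addrA dvdp_addr; last by apply: dvX px; lia.
rewrite dvdp_addr; last by apply: dvdp_mulr; apply: dvX py; lia.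
rewrite !irreducible_dvdpM // !negb_or (dvdp_subl _ (dvX _ _ N0 px)) (dvdp_subl _ (dvX _ _ N0 py)).
by apply/andP; split; first apply/andP; try split; apply: contra pz; apply: irreducible_dvdpX.
Qed.

Lemma coprimep_small_factors r p g :
  (forall c, irreducible_poly c -> (size c <= r.+1)%N -> ~~ (c %| g)) ->
  p != 0 -> (size p <= r.+1)%N -> coprimep p g.
Proof.
move=> nd p0 szp; rewrite /coprimep; apply: contraT => szg.
have gc0 : gcdp p g != 0 by rewrite gcdp_eq0 (negPf p0).
have [|c irr dvc] := @irreducible_factor (gcdp p g).
  have : (0 < size (gcdp p g))%N by rewrite size_poly_gt0.
  by move: szg; case: (size (gcdp p g)) => [|[|]].
have szc : (size c <= r.+1)%N.
  by rewrite (leq_trans _ szp) // dvdp_leq // (dvdp_trans dvc (dvdp_gcdl _ _)).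
by have := nd c irr szc; rewrite (dvdp_trans dvc (dvdp_gcdr _ _)).
Qed.

Lemma coprimep_sq_modulus r g :
  (forall c, irreducible_poly c -> (size c <= r.+1)%N -> ~~ (c %| g)) ->
  coprimep (sq_modulus F r) g.
Proof.
move=> nd; rewrite /sq_modulus; elim/big_rec: _ => [|v M v0 coM]; first exact: coprime1p.
rewrite coprimepMl coM coprimep_expl //; apply: (coprimep_small_factors nd).
  by apply: contra v0 => /eqP h; rewrite -(rVpolyK v) h linear0.
exact: size_poly.
Qed.

(** Every relevant [p ^+ 2] divides [sq_modulus F r], hence is coprime to [u] and can be cancelled
    against it. *)
Lemma has_sqM_coprime r g u : coprimep (sq_modulus F r) u ->
  has_sq r (g * u) = has_sq r g.
Proof.
move=> co; apply/has_sqP/has_sqP => -[p [sz dv]]; exists p; split=> //; last first.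
  exact: dvdp_mulr.
rewrite -(Gauss_dvdpl _ (_ : coprimep _ u)) //.
apply: coprimep_dvdr co; apply: dvdp_sq_modulus; last by case/andP: sz.
by rewrite -size_poly_gt0; case/andP: sz => /ltnW.
Qed.

End Multiplier.

(** * Restriction of a form to a line *)

Section Restriction.
Variable F : finFieldType.
Implicit Types (f : {mpoly F[3]}) (P Q : 'rV[F]_3) (h k : {mpoly F[2]}).

(* The restriction of [f] to the line through [P] and [Q], in the affine
   coordinate for which [Q] is the origin and [P] the point at infinity. *)
Definition rest P Q f : {poly F} :=
  mmap (@polyC F) (fun i => (P ord0 i)%:P * 'X + (Q ord0 i)%:P) f.

HB.instance Definition _ P Q := GRing.RMorphism.copy (rest P Q)
  (mmap (@polyC F) (fun i => (P ord0 i)%:P * 'X + (Q ord0 i)%:P)).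

(* [psi h] is h(XT, T), where T is the outer variable: a form of degree n is sent to [p%:P * 'X^n], [p]
   being its dehomogenisation. *)
Definition psi h : {poly {poly F}} :=
  mmap (polyC \o @polyC F)
       (fun i : 'I_2 => if i == ord0 then 'X%:P * 'X else 'X) h.

HB.instance Definition _ := GRing.RMorphism.copy psi
  (mmap (polyC \o @polyC F)
       (fun i : 'I_2 => if i == ord0 then 'X%:P * 'X else 'X)).

(** The other affine chart: setting the first variable to [1] turns the restriction to the line
    through [P] and [Q] into [rest Q P f]. *)
Definition dehom h : {poly F} :=
  mmap (@polyC F) (fun i : 'I_2 => if i == ord0 then 1 else 'X) h.

HB.instance Definition _ := GRing.RMorphism.copy dehom
  (mmap (@polyC F) (fun i : 'I_2 => if i == ord0 then 1 else 'X)).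

Lemma restZ c f P Q : rest P Q (c *: f) = c *: rest P Q f.
Proof. by rewrite /rest mmapZ mul_polyC. Qed.

Lemma psiC c : psi c%:MP = c%:P%:P.
Proof. exact: mmapC. Qed.

Lemma psiZ c h : psi (c *: h) = c%:P%:P * psi h.
Proof. exact: mmapZ. Qed.

Lemma psi0 : psi 'X_ord0 = 'X%:P * 'X.
Proof. by rewrite /psi mmapX mmap1U eqxx. Qed.

Lemma psi1 : psi 'X_ord_max = 'X.
Proof. by rewrite /psi mmapX mmap1U. Qed.

Lemma dehom0 : dehom 'X_ord0 = 1.
Proof. by rewrite /dehom mmapX mmap1U eqxx. Qed.

Lemma dehom1 : dehom 'X_ord_max = 'X.
Proof. by rewrite /dehom mmapX mmap1U. Qed.

Lemma dehomC c : dehom c%:MP = c%:P.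
Proof. exact: mmapC. Qed.

Lemma dehomZ c h : dehom (c *: h) = c *: dehom h.
Proof. by rewrite /dehom mmapZ mul_polyC. Qed.

Lemma mdeg2 (m : 'X_{1..2}) : mdeg m = (m ord0 + m ord_max)%N.
Proof.
rewrite mdegE big_ord_recl big_ord1; congr (_ + m _)%N; exact: val_inj.
Qed.

(** [psi] sends the monomial [s^i t^j] to [X^i T^(i+j)], so the two exponents of the image recover
    [i] and [j]. *)
Lemma coef_psi h (m : 'X_{1..2}) : ((psi h)`_(mdeg m))`_(m ord0) = h@_m.
Proof.
have coefX (m' : 'X_{1..2}) : ((psi 'X_[m'])`_(mdeg m))`_(m ord0) = (m' == m)%:R.
  rewrite /psi mmapX /mmap1 big_ord_recl big_ord1 /=.
  have -> : lift ord0 ord0 = ord_max :> 'I_2 by apply: val_inj.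
  rewrite exprMn -mulrA -exprD -mdeg2 -polyC_exp coefCM coefXn.
  have [->|neq] := eqVneq m' m; first by rewrite eqxx mulr1 coefXn eqxx.
  have [eqd|_] := eqVneq (mdeg m) (mdeg m'); last by rewrite mulr0 coef0.
  rewrite mulr1 coefXn; have [eq0|//] := eqVneq (m ord0) (m' ord0).
  case/eqP: neq; apply/mnmP => i; move: eqd; rewrite !mdeg2 eq0 => /addnI eq1.
  have [|] := boolP (i == ord0) => [/eqP->//|ni0].
  have -> : i = ord_max by apply: val_inj; case: i ni0 => -[|[|]].
  by [].
rewrite [in LHS](mpolyE h) rmorph_sum /= !coef_sum.
transitivity (\sum_(m' <- msupp h) h@_m' * (m' == m)%:R).
  by apply: eq_bigr => m' _; rewrite psiZ !coefCM coefX.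
have [mh|mh] := boolP (m \in msupp h).
  rewrite (bigD1_seq m) ?msupp_uniq //= eqxx mulr1 big1 ?addr0 // => m' /negPf->.
  by rewrite mulr0.
rewrite (memN_msupp_eq0 mh) big_seq big1 // => m' m'h.
by have [e|] := eqVneq m' m; rewrite ?mulr0 // -e m'h in mh *.
Qed.

Lemma psi_inj : injective psi.
Proof. by move=> h k e; apply/mpolyP => m; rewrite -!coef_psi e. Qed.

Lemma psi_restrict d f P Q : f \is d.-homog ->
  psi (restrict f P Q) = (rest P Q f)%:P * 'X^d.
Proof.
move=> /dhomogP hf; rewrite /restrict /comp_mpoly /rest /mmap !rmorph_sum /= mulr_suml.
rewrite big_seq [RHS]big_seq; apply: eq_bigr => m /hf dm.
rewrite !rmorphM /= psiC -mulrA; congr (_ * _).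
have {dm} <- : mdeg m = d by exact: dm.
rewrite /mmap1 !rmorph_prod /= mdegE -prodrXr -big_split /=.
apply: eq_bigr => i _; rewrite !rmorphXn /= -exprMn; congr (_ ^+ _).
rewrite tnth_mktuple rmorphD /= !psiZ psi0 psi1 rmorphD rmorphM /=; ring.
Qed.

Lemma dehom_restrict f P Q : dehom (restrict f P Q) = rest Q P f.
Proof.
rewrite /restrict /comp_mpoly /rest /mmap !rmorph_sum /=.
apply: eq_bigr => m _.
rewrite !rmorphM /= dehomC; congr (_ * _).
rewrite /mmap1 !rmorph_prod /=.
apply: eq_bigr => i _; rewrite !rmorphXn /=; congr (_ ^+ _).
rewrite tnth_mktuple rmorphD /= !dehomZ dehom0 dehom1 !mul_polyC alg_polyC; ring.
Qed.

Lemma size_mul_le a b (p q : {poly F}) : (size p <= a.+1)%N -> (size q <= b.+1)%N ->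
  (size (p * q)%R <= (a + b).+1)%N.
Proof.
move=> szp szq; rewrite (leq_trans (size_polyMleq _ _)) //; move: szp szq.
by move: (size p) (size q) => x y; lia.
Qed.

Lemma size_exp_le a (k : nat) (p : {poly F}) : (size p <= a.+1)%N -> (size (p ^+ k)%R <= (a * k).+1)%N.
Proof.
move=> szp; elim: k => [|k IHk]; first by rewrite expr0 size_poly1.
by rewrite exprS mulnS size_mul_le.
Qed.

Lemma size_rest d f P Q : f \is d.-homog -> (size (rest P Q f) <= d.+1)%N.
Proof.
move=> /dhomogP hf; rewrite /rest /mmap big_seq.
apply: (big_ind (fun p : {poly F} => (size p <= d.+1)%N)) => [|p q szp szq|m /hf dm]; first by rewrite size_poly0.
  by rewrite (leq_trans (size_polyD _ _)) // geq_max szp.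
have {dm} <- : mdeg m = d by exact: dm.
rewrite mul_polyC (leq_trans (size_scale_leq _ _)) // /mmap1 mdegE.
pose K (p : {poly F}) (n : nat) := (size p <= n.+1)%N.
rewrite -/(K _ _); apply: (big_ind2 K); rewrite /K.
- by rewrite size_poly1.
- by move=> p k q l; apply: size_mul_le.
move=> i _; rewrite -[X in (_ <= X.+1)%N]mul1n; apply: size_exp_le.
rewrite (leq_trans (size_polyD _ _)) // geq_max (leq_trans (size_polyC_leq1 _)) // andbT.
by rewrite mul_polyC (leq_trans (size_scale_leq _ _)) // size_polyX.
Qed.

(** * Homogenisation and the change of affine chart *)

Definition hom n (p : {poly F}) : {mpoly F[2]} :=
  \sum_(i < n.+1) p`_i *: ('X_ord0 ^+ i * 'X_ord_max ^+ (n - i)).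

(** The reciprocal polynomial [X^n p(1/X)], that is, the form [hom n p] read in the other chart. *)
Definition rev_poly n (p : {poly F}) : {poly F} :=
  \sum_(i < n.+1) p`_i *: 'X^(n - i).

Lemma psi_hom n (p : {poly F}) : (size p <= n.+1)%N -> psi (hom n p) = p%:P * 'X^n.
Proof.
move=> szp; rewrite /hom rmorph_sum /=.
have -> : p%:P * 'X^n = (\sum_(i < n.+1) p`_i *: 'X^i)%:P * 'X^n.
  congr (_%:P * _); rewrite -poly_def; apply/polyP => i; rewrite coef_poly.
  by case: ltnP => // le_i; rewrite nth_default // (leq_trans szp).
rewrite rmorph_sum mulr_suml; apply: eq_bigr => i _.
rewrite psiZ rmorphM !rmorphXn /= psi0 psi1 exprMn -mulrA -exprD subnKC; last by rewrite -ltnS.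
by rewrite mulrA -mul_polyC rmorphM rmorphXn.
Qed.

Lemma dehom_hom n p : dehom (hom n p) = rev_poly n p.
Proof.
rewrite /hom rmorph_sum /=; apply: eq_bigr => i _.
by rewrite dehomZ rmorphM !rmorphXn /= dehom0 dehom1 expr1n mul1r.
Qed.

Lemma homM a b (p q : {poly F}) : (size p <= a.+1)%N -> (size q <= b.+1)%N ->
  hom (a + b) (p * q) = hom a p * hom b q.
Proof.
move=> szp szq; apply: psi_inj; rewrite rmorphM /= !psi_hom ?rmorphM /= ?exprD; first by ring.
  exact: szq.
  exact: szp.
exact: size_mul_le.
Qed.

Lemma rev_polyM a b (p q : {poly F}) : (size p <= a.+1)%N -> (size q <= b.+1)%N ->
  rev_poly (a + b) (p * q) = rev_poly a p * rev_poly b q.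
Proof. by move=> szp szq; rewrite -!dehom_hom homM // rmorphM. Qed.

Lemma coef_rev_poly n p j : (j <= n)%N -> (rev_poly n p)`_j = p`_(n - j).
Proof.
move=> le_j; rewrite /rev_poly coef_sum.
have lt : (n - j < n.+1)%N by rewrite ltnS leq_subr.
rewrite (bigD1 (Ordinal lt)) //= coefZ coefXn subKn // eqxx mulr1.
rewrite big1 ?addr0 // => i /eqP ni; rewrite coefZ coefXn.
have [e|] := eqVneq j (n - i)%N; last by rewrite mulr0.
case: ni; apply: val_inj => /=; have := ltn_ord i; lia.
Qed.

Lemma restrict_hom d f P Q : f \is d.-homog -> restrict f P Q = hom d (rest P Q f).
Proof.
by move=> hf; apply: psi_inj; rewrite (psi_restrict _ _ hf) psi_hom // size_rest.
Qed.

Lemma rest_rev d f P Q : f \is d.-homog -> rest Q P f = rev_poly d (rest P Q f).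
Proof. by move=> hf; rewrite -dehom_restrict (restrict_hom _ _ hf) dehom_hom. Qed.

(** The second chart adds only the point [P]. If [p ^+ 2] divides [rest Q P f] and [p] does not
    vanish at [0], the reversal of [p] works in the first chart; otherwise ['X ^+ 2] divides
    [rest Q P f], so the two top coefficients in the first chart vanish. *)
Lemma has_sq_rev d r f P Q : f \is d.-homog -> (0 < d)%N ->
  has_sq r (rest Q P f) ->
  has_sq r (rest P Q f) \/ (rest P Q f)`_d = 0 /\ (rest P Q f)`_d.-1 = 0.
Proof.
move=> hf d0 /has_sqP[p [/andP[sz1 sz2] dv]].
have top : (rest Q P f)`_0 = 0 -> (rest Q P f)`_1 = 0 ->
    (rest P Q f)`_d = 0 /\ (rest P Q f)`_d.-1 = 0.
  by rewrite (rest_rev P Q hf) !coef_rev_poly // subn0 subn1.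
have [b0|b0] := eqVneq (rest Q P f) 0; first by right; apply: top; rewrite b0 coef0.
have szb := size_rest Q P hf; have lt_pb := ltn_size_sqrp b0 dv.
have [p0|p0] := eqVneq p`_0 0.
  right; have /dvdpP[k ek] : 'X ^+ 2 %| rest Q P f.
    apply: dvdp_trans dv; rewrite dvdp_exp2r //.
    by rewrite -[X in X %| _]subr0 -polyC0 dvdp_XsubCl rootE horner_coef0 p0.
  by apply: top; rewrite ek coefMXn.
left; move/dvdpP: dv => [k ek].
pose e := (size p).-1.
have pn0 : p != 0 by apply: contraNneq p0 => ->; rewrite coef0.
have kn0 : k != 0 by apply: contraNneq b0 => k0; rewrite ek k0 mul0r.
have sz_p : size p = e.+1 by rewrite prednK // ltnW.
have le_ed : (e + e <= d)%N.
  by move: lt_pb szb; rewrite sz_p /=; move: (size (rest Q P f)) => x; lia.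
have szk : (size k <= (d - (e + e)).+1)%N.
  move: szb; rewrite ek expr2 !size_mul ?mulf_neq0 // sz_p.
  have : (0 < size k)%N by rewrite size_poly_gt0.
  by move: (size k) => x; lia.
have szpp : (size (p * p)%R <= (e + e).+1)%N by apply: size_mul_le; rewrite sz_p.
apply/has_sqP; exists (rev_poly e p); split; last first.
  suff -> : rest P Q f = rev_poly e p ^+ 2 * rev_poly (d - (e + e)) k by rewrite dvdp_mulr.
  rewrite (rest_rev Q P hf) ek mulrC -{1}(subnKC le_ed) expr2 rev_polyM //.
  by rewrite rev_polyM ?sz_p.
(* Reversal keeps the degree because the constant coefficient of [p] is nonzero. *)
have -> : size (rev_poly e p) = e.+1; last by rewrite -sz_p sz1 sz2.
apply/eqP; rewrite eqn_leq; apply/andP; split.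
  apply/leq_sizeP => j le_j; rewrite /rev_poly coef_sum big1 // => i _.
  by rewrite coefZ coefXn gtn_eqF ?mulr0 // (leq_ltn_trans (leq_subr _ _)).
by rewrite ltnNge; apply: contra p0 => /leq_sizeP/(_ e (leqnn _)); rewrite coef_rev_poly // subnn => ->.
Qed.

Lemma dvd_monomial (D : idomainType) (p q : {poly D}) (c : D) d : c != 0 ->
  p * q = c%:P * 'X^d -> exists a e, p = a%:P * 'X^e.
Proof.
move=> c0 epq; have : p %| 'X^d.
  by rewrite -(dvdpZr _ _ c0) -mul_polyC -epq dvdp_mulr.
rewrite -['X]subr0 -polyC0 => /dvdp_exp_XsubCP[e _]; rewrite polyC0 subr0.
case/eqpP => -[a b] /= /andP[a0 b0] eab; exists p`_e, e.
apply: (@mulfI _ a%:P); first by rewrite polyC_eq0.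
rewrite mulrA -polyCM !mul_polyC eab; congr (_ *: _).
by have := congr1 (fun u : {poly D} => u`_e) eab; rewrite !coefZ coefXn eqxx mulr1.
Qed.

(** Nothing assumes [h] homogeneous, but for a nonzero restriction [psi h] divides a monomial in
    [T], so [psi h] is [a T^e]. If [a] is nonconstant, its square divides [rest P Q f]; otherwise
    [h] is a multiple of a power of the second variable, and the square appears in the other
    chart. *)
Lemma has_sq_of_mult d f P Q h : f \is d.-homog -> (0 < d)%N -> (1 < msize h)%N ->
  mult_ge2_at (restrict f P Q) h -> has_sq d (rest P Q f) || has_sq d (rest Q P f).
Proof.
move=> hf d0 szh [k ek].
have small (p g : {poly F}) : (size g <= d.+1)%N -> (1 < size p)%N -> p ^+ 2 %| g -> has_sq d g.
  move=> szg szp dv; apply/has_sqP; have [g0|g0] := eqVneq g 0.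
    by exists 'X; rewrite size_polyX g0 dvdp0.
  by exists p; rewrite szp (leq_size_sq g0 dv).
have := psi_restrict P Q hf; rewrite ek rmorphM rmorphXn /= => epsi.
have [a0|a0] := eqVneq (rest P Q f) 0.
  by rewrite (small 'X) ?a0 ?size_poly0 ?size_polyX ?dvdp0.
have [a [e eh]] : exists a e, psi h = a%:P * 'X^e.
  by apply: (@dvd_monomial _ _ (psi h * psi k) _ d a0); rewrite -epsi expr2 mulrA.
(* Evaluation of the outer variable at [1]. *)
have ea : rest P Q f = a ^+ 2 * (psi k).[1].
  have := congr1 (fun u : {poly {poly F}} => u.[1]) epsi.
  by rewrite /= !hornerM eh !hornerM !hornerC !hornerXn !expr1n !mulr1 => <-.
have [sza|sza] := ltnP 1 (size a).
  by rewrite (small a) ?size_rest // ea dvdp_mulr.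
have [c ec] : exists c, a = c%:P by exists a`_0; apply: size1_polyC.
have eqh : h = c *: 'X_ord_max ^+ e.
  by apply: psi_inj; rewrite eh psiZ rmorphXn /= psi1 ec.
apply/orP; right; apply: (small ('X ^+ e)); first exact: size_rest.
  rewrite size_polyXn ltnS lt0n; apply: contraTneq szh => e0.
  by rewrite eqh e0 expr0 -leqNgt -mul_mpolyC mulr1 msizeC; case: (_ != 0).
rewrite -dehom_restrict ek rmorphM rmorphXn /= eqh dehomZ rmorphXn /= dehom1.
by rewrite exprZn -scalerAl -mul_polyC mulrCA dvdp_mulr.
Qed.

(** Induction on the size: a reducible [h] is replaced by one of its proper factors. *)
Lemma tangent_of_nonconst_sq g h : (1 < msize h)%N -> mult_ge2_at g h ->
  exists h', irreducible_mpoly h' /\ mult_ge2_at g h'.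
Proof.
have [n] := ubnP (msize h); elim: n h => // n IHn h lt_hn szh dv.
have [irr|nirr] := Classical_Prop.classic (irreducible_mpoly h); first by exists h.
have [a [b [eh sza szb]]] : exists a b, [/\ h = a * b, (1 < msize a)%N & (1 < msize b)%N].
  apply: Classical_Prop.NNPP => nex; apply: nirr; split=> // a b eh.
  have [sza|sza] := leqP (msize a) 1; first by left.
  have [szb|szb] := leqP (msize b) 1; first by right.
  by case: nex; exists a, b.
have nz (u : {mpoly F[2]}) : (1 < msize u)%N -> u != 0.
  by move=> szu; apply: contraTneq szu => ->; rewrite mmeasure0.
apply: (IHn a) => //.
  rewrite -ltnS; apply: leq_trans lt_hn; rewrite ltnS eh msizeM ?nz //.
  by move: szb; move: (msize a) (msize b) => x y; lia.
by case: dv => k ->; exists (b ^+ 2 * k); rewrite eh exprMn mulrA.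
Qed.

(** A square factor in the first chart is homogenised; the only other possibility is a double zero
    at [P], where the second variable vanishes. *)
Lemma mult_of_has_sq r d f P Q : f \is d.-homog -> (0 < d)%N ->
  has_sq r (rest P Q f) || has_sq r (rest Q P f) ->
  exists h, (1 < msize h)%N /\ mult_ge2_at (restrict f P Q) h.
Proof.
move=> hf d0 sq.
have szX (i : 'I_2) : (1 < msize ('X_i : {mpoly F[2]}))%N by rewrite msizeX mdeg1.
have sz := size_rest P Q hf.
have [a0|a0] := eqVneq (rest P Q f) 0.
  exists 'X_ord0; split=> //; exists 0; rewrite mulr0; apply: psi_inj.
  by rewrite (psi_restrict P Q hf) a0 polyC0 mul0r rmorph0.
have {sq} [|[c0 c1]] : has_sq r (rest P Q f) \/
    (rest P Q f)`_d = 0 /\ (rest P Q f)`_d.-1 = 0.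
- by case/orP: sq => [|/(has_sq_rev hf d0)]; [left|].
- move=> /has_sqP[p [/andP[szp _] dv]].
  have lt_p := ltn_size_sqrp a0 dv.
  move/dvdpP: dv => [k ek]; pose e := (size p).-1.
  have sz_p : size p = e.+1 by rewrite prednK // ltnW.
  have pn0 : p != 0 by rewrite -size_poly_gt0 sz_p.
  have kn0 : k != 0 by apply: contraNneq a0 => k0; rewrite ek k0 mul0r.
  have le_ed : (e + e <= d)%N.
    by move: lt_p sz; rewrite sz_p /=; move: (size (rest P Q f)) => x; lia.
  have szk : (size k <= (d - (e + e)).+1)%N.
    move: sz; rewrite ek expr2 !size_mul ?mulf_neq0 // sz_p.
    have : (0 < size k)%N by rewrite size_poly_gt0.
    by move: (size k) => x; lia.
  have szpp : (size (p * p)%R <= (e + e).+1)%N by apply: size_mul_le; rewrite sz_p.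
  have e0 : (0 < e)%N by rewrite -ltnS -sz_p.
  exists (hom e p); split; last first.
    exists (hom (d - (e + e)) k).
    by rewrite (restrict_hom P Q hf) ek expr2 mulrC -{1}(subnKC le_ed) homM // homM ?sz_p // expr2.
  rewrite ltnNge; apply/negP => /msize1_polyC e1.
  have := @psi_hom e p; rewrite sz_p e1 psiC => /(_ (leqnn _)) /(congr1 (fun u : {poly {poly F}} => u`_e)).
  rewrite coefCM coefXn eqxx mulr1 coefC gtn_eqF // => /esym/eqP; exact/negP.
have sz2 : (size (rest P Q f) <= d.-1)%N.
  apply/leq_sizeP => j; rewrite leq_eqVlt => /orP[/eqP<-//|].
  rewrite prednK // leq_eqVlt => /orP[/eqP<-//|lt_j].
  by rewrite nth_default // (leq_trans sz).
have d2 : (1 < d)%N.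
  by rewrite ltnNge; apply: contra a0 => le_d; rewrite -size_poly_eq0 -leqn0 (leq_trans sz2) // -ltnS prednK.
exists 'X_ord_max; split=> //; exists (hom (d - 2) (rest P Q f)).
apply: psi_inj; rewrite (psi_restrict P Q hf) rmorphM rmorphXn /= psi1 psi_hom; last first.
  by apply: (leq_trans sz2); lia.
by rewrite mulrCA -exprD subnKC.
Qed.

(** Both charts are tested because each one misses a point of the line. *)
Definition tangent_upto r f P Q := has_sq r (rest P Q f) || has_sq r (rest Q P f).

Lemma transverseP d f P Q : f \is d.-homog -> (0 < d)%N ->
  ~ transverse f P Q <-> tangent_upto d f P Q.
Proof.
move=> hf d0; split=> [/Classical_Prop.NNPP[h [[szh _] dv]]|].
  exact: has_sq_of_mult dv.
by move=> /(mult_of_has_sq hf d0)[h [szh dv]] []; apply: tangent_of_nonconst_sq dv.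
Qed.

End Restriction.

(** * Counting forms *)

Section Forms.
Variable F : finFieldType.
Implicit Types (f g : {mpoly F[3]}) (P Q c : 'rV[F]_3) (d : nat).

Lemma poly_of_coefs_homog d (c : {ffun mon d -> F}) : poly_of_coefs c \is d.-homog.
Proof.
rewrite /poly_of_coefs; apply: rpred_sum => m _; apply: dhomogZ.
by rewrite dhomogX; exact: (valP m).
Qed.

Definition coefs_of d f : {ffun mon d -> F} := [ffun m => f@_(val (val m))].

Lemma poly_of_coefsK d f : f \is d.-homog -> poly_of_coefs (coefs_of d f) = f.
Proof.
move=> hf; apply/mpolyP => m; rewrite /poly_of_coefs raddf_sum /=.
have coefm (m' : mon d) : ((coefs_of d f) m' *: 'X_[val (val m')])@_m
    = f@_m * (val (val m') == m)%:R.
  by rewrite mcoeffZ mcoeffX ffunE; have [->|] := eqVneq; rewrite ?mulr0.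
under eq_bigr => m' _ do rewrite coefm.
have [dm|dm] := eqVneq (mdeg m) d; last first.
  have -> : f@_m = 0 by apply: (dhomog_nemf_coeff hf); exact: dm.
  by rewrite big1 // => m' _; rewrite mul0r.
have lt_m : (mdeg m < d.+1)%N by rewrite dm.
have dm' : mdeg (val (BMultinom lt_m)) == d by rewrite /= dm.
pose m0 : mon d := Sub (BMultinom lt_m) dm'.
rewrite (bigD1 m0) //= eqxx mulr1 big1 ?addr0 // => m' ne.
have [e|_] := eqVneq (val (val m')) m; last by rewrite mulr0.
by case/eqP: ne; apply: val_inj; apply: val_inj.
Qed.

Lemma poly_of_coefsD d (c c' : {ffun mon d -> F}) :
  poly_of_coefs (c + c') = poly_of_coefs c + poly_of_coefs c'.
Proof.
rewrite /poly_of_coefs -big_split /=; apply: eq_bigr => m _.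
by rewrite ffunE scalerDl.
Qed.

Definition cnt d (A : pred {mpoly F[3]}) :=
  #|[set c : {ffun mon d -> F} | A (poly_of_coefs c)]|.

Lemma cntT d : cnt d xpredT = #|{ffun mon d -> F}|.
Proof. by rewrite /cnt -cardsT; apply: eq_card => c; rewrite !inE. Qed.

Lemma leq_cnt d (A B : pred {mpoly F[3]}) :
  (forall f, f \is d.-homog -> A f -> B f) -> (cnt d A <= cnt d B)%N.
Proof.
move=> AB; apply/subset_leq_card/subsetP => c; rewrite !inE.
exact: AB (poly_of_coefs_homog c).
Qed.

Lemma eq_cnt d (A B : pred {mpoly F[3]}) :
  (forall f, f \is d.-homog -> A f = B f) -> cnt d A = cnt d B.
Proof.
by move=> AB; apply/eqP; rewrite eqn_leq !leq_cnt // => f hf; rewrite AB.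
Qed.

Lemma cnt_predU d (A B : pred {mpoly F[3]}) :
  (cnt d (fun f => A f || B f) <= cnt d A + cnt d B)%N.
Proof.
apply: leq_trans (leq_card_setU _ _).1; apply/subset_leq_card/subsetP => c.
by rewrite !inE.
Qed.

Lemma cnt_predC d (A B : pred {mpoly F[3]}) :
  (cnt d A = cnt d (fun f => A f && B f) + cnt d (fun f => A f && ~~ B f))%N.
Proof.
rewrite /cnt -(cardsID [set c | B (poly_of_coefs c)] [set c | A _]).
by congr (_ + _)%N; apply: eq_card => c; rewrite !inE // andbC.
Qed.

(** The counting principle behind all probability estimates: randomise [f] by adding [Phi h], and
    bound the proportion of [h] that lead into [A] by [K / #|H|] for each [f] in [C]. *)
Lemma cnt_shift d (H : finType) (Phi : H -> {mpoly F[3]}) (A C : pred {mpoly F[3]}) K :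
  (forall h, Phi h \is d.-homog) ->
  (forall f h, f \is d.-homog -> A (f + Phi h) -> C f) ->
  (forall f, f \is d.-homog -> C f -> (#|[set h | A (f + Phi h)%R]| <= K)%N) ->
  (cnt d A * #|H| <= cnt d C * K)%N.
Proof.
move=> hPhi AC boundK.
pose sh (h : H) (c : {ffun mon d -> F}) : {ffun mon d -> F} := c + coefs_of d (Phi h).
rewrite /cnt; apply: (card_shift_le (sh := sh)); rewrite /sh.
- by move=> h; apply: addIr.
- move=> c h; rewrite !inE poly_of_coefsD poly_of_coefsK //.
  exact: AC (poly_of_coefs_homog c).
move=> c; rewrite inE => Cc; apply: leq_trans (boundK _ (poly_of_coefs_homog c) Cc).
apply/subset_leq_card/subsetP => h; rewrite !inE poly_of_coefsD poly_of_coefsK //.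
Qed.

(** * Linear forms and forms with prescribed restriction to a line *)

Definition dot c P := \sum_i c ord0 i * P ord0 i.

Definition lin c : {mpoly F[3]} := \sum_i c ord0 i *: 'X_i.

Lemma rest_lin P Q c : rest P Q (lin c) = (dot c P)%:P * 'X + (dot c Q)%:P.
Proof.
rewrite /lin rmorph_sum /= /dot !rmorph_sum /= mulr_suml -big_split /=.
apply: eq_bigr => i _; rewrite restZ /rest mmapX mmap1U -mul_polyC !rmorphM /=; ring.
Qed.

Lemma lin_homog c : lin c \is (1%N).-homog.
Proof. by apply: rpred_sum => i _; apply: dhomogZ; rewrite dhomogX /= mdeg1. Qed.

Lemma homogX f k n : f \is k.-homog -> f ^+ n \is (k * n).-homog.
Proof. exact: dhomogMn. Qed.

Lemma homogM f g k b n : f \is k.-homog -> g \is b.-homog -> (k + b = n)%N ->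
  f * g \is n.-homog.
Proof. by move=> hf hg <-; apply: dhomogM. Qed.

Lemma linX_homog c n : lin c ^+ n \is n.-homog.
Proof. by rewrite -{2}[n]mul1n; apply: homogX; apply: lin_homog. Qed.

(** On the line through [P] and [Q], [lin l] restricts to [X] and [lin m] to [1]. *)
Definition dual P Q l m := [/\ dot l P = 1, dot l Q = 0, dot m P = 0 & dot m Q = 1].

Lemma dotE c P : (P *m c^T) ord0 ord0 = dot c P.
Proof. by rewrite mxE; apply: eq_bigr => i _; rewrite mxE mulrC. Qed.

Lemma row_free_dual P Q : row_free (col_mx P Q) <-> exists l m, dual P Q l m.
Proof.
split=> [/row_freeP[B eB]|[l [m [lP lQ mP mQ]]]].
  have key (u : 'rV[F]_3) (j : 'I_(1 + 1)) : dot (col j B)^T u = (u *m B) ord0 j.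
    by rewrite mxE; apply: eq_bigr => i _; rewrite !mxE mulrC.
  move: eB; rewrite mul_col_mx => eB.
  have eU i : (P *m B) ord0 i = (1%:M : 'M[F]_(1 + 1)) (lshift 1 ord0) i.
    by rewrite -eB col_mxEu.
  have eD i : (Q *m B) ord0 i = (1%:M : 'M[F]_(1 + 1)) (rshift 1 ord0) i.
    by rewrite -eB col_mxEd.
  exists (col (lshift 1 ord0) B)^T, (col (rshift 1 ord0) B)^T.
  by split; rewrite key ?eU ?eD !mxE.
apply/row_freeP; exists (row_mx l^T m^T).
rewrite mul_col_row scalar_mx_block; congr block_mx; apply/matrixP => i j;
  by rewrite !ord1 dotE ?lP ?lQ ?mP ?mQ !mxE ?eqxx.
Qed.

Lemma dual_sym P Q l m : dual P Q l m -> dual Q P m l.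
Proof. by case. Qed.

Definition ev f P := f.@[fun i => P ord0 i].

Lemma horner_rest f P Q b : (rest P Q f).[b] = ev f (b *: P + Q).
Proof.
rewrite /rest /ev /meval /mmap horner_sum; apply: eq_bigr => m _.
rewrite hornerM hornerC; congr (_ * _); rewrite /mmap1 horner_prod.
by apply: eq_bigr => i _; rewrite horner_exp !hornerE !mxE mulrC.
Qed.

Lemma coef_rest_top d f P Q : f \is d.-homog -> (rest P Q f)`_d = ev f P.
Proof.
move=> hf; rewrite (rest_rev Q P hf) coef_rev_poly // subnn -horner_coef0.
by rewrite horner_rest scale0r add0r.
Qed.

(** A lift of the polynomial coded by [w] to a form of degree [d]: with dual [l] and [m], its
    restriction is that polynomial. *)
Definition bform d (n : nat) (l m : 'rV[F]_3) (w : 'rV[F]_n) : {mpoly F[3]} :=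
  \sum_(i < n) w ord0 i *: (lin l ^+ i * lin m ^+ (d - i)).

Lemma bform_homog d n l m (w : 'rV[F]_n) : (n <= d.+1)%N -> bform d l m w \is d.-homog.
Proof.
move=> le_n; apply: rpred_sum => i _; apply: dhomogZ.
apply: homogM (linX_homog _ _) (linX_homog _ _) _.
by rewrite subnKC // -ltnS (leq_trans (ltn_ord i)).
Qed.

Lemma rest_bform d n P Q l m (w : 'rV[F]_n) : dual P Q l m ->
  rest P Q (bform d l m w) = rVpoly w.
Proof.
move=> [lP lQ mP mQ]; rewrite /bform rmorph_sum /= /rVpoly poly_def.
apply: eq_bigr => i _; rewrite restZ rmorphM !rmorphXn /= !rest_lin lP lQ mP mQ.
by rewrite !mul0r !add0r !addr0 mul1r expr1n mulr1 valK.
Qed.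

(** With at most [d] coefficients every term keeps a positive power of [lin m], so the form vanishes
    on the line where [lin m] does. *)
Lemma rest_bform0 d n P Q l m (w : 'rV[F]_n) : (n <= d)%N ->
  dot m P = 0 -> dot m Q = 0 -> rest P Q (bform d l m w) = 0.
Proof.
move=> le_n mP mQ; rewrite /bform rmorph_sum /= big1 // => i _.
rewrite restZ rmorphM !rmorphXn /= !rest_lin mP mQ mul0r addr0 expr0n.
have /negPf-> : (d - i)%N != 0 by rewrite -lt0n subn_gt0 (leq_trans (ltn_ord i)).
by rewrite mulr0 scaler0.
Qed.

End Forms.

(** * The upper bound *)

Section UpperBound.
Variable F : finFieldType.
Implicit Types (f g : {mpoly F[3]}) (P Q : 'rV[F]_3) (d r : nat).

Definition tangent_all r f :=
  [forall P : 'rV[F]_3, forall Q : 'rV[F]_3,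
    row_free (col_mx P Q) ==> tangent_upto r f P Q].

Lemma tangent_allP r f :
  reflect (forall P Q, row_free (col_mx P Q) -> tangent_upto r f P Q) (tangent_all r f).
Proof.
apply: (iffP forallP) => [h P Q rf|h P]; first by move/forallP/(_ Q)/implyP: (h P); apply.
by apply/forallP => Q; apply/implyP; apply: h.
Qed.

Lemma sq_deg_gt0 r : (0 < r)%N -> (0 < sq_deg F r)%N.
Proof.
move=> r0; have dv : ('X ^+ 2 : {poly F}) %| sq_modulus F r.
  by apply: dvdp_sq_modulus; rewrite ?polyX_eq0 ?size_polyX.
have := dvdp_leq (sq_modulus_neq0 F r) dv; rewrite size_polyXn /sq_deg.
by case: (size _) => [|[|]].
Qed.

(** Given any condition [C] that ignores the low coefficients on the line, a small square factor has
    conditional probability at most [1/q]: the shifts run through all residues modulo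
    [sq_modulus F r]. *)
Lemma cnt_has_sq d r P Q l m (C : pred {mpoly F[3]}) :
  (0 < r)%N -> (sq_deg F r <= d.+1)%N -> dual P Q l m ->
  (forall f (w : 'rV[F]_(sq_deg F r)), f \is d.-homog -> C (f + bform d l m w) = C f) ->
  (cnt d (fun f => C f && has_sq r (rest P Q f)) * #|F| <= cnt d C)%N.
Proof.
move=> r0 le_d dPQ invC; set A := fun f => _; set n := sq_deg F r in le_d invC *.
have q0 : (0 < #|F|)%N by apply: ltnW; apply: card_finField_gt1.
have en : (#|F| ^ n = #|F| ^ n.-1 * #|F|)%N by rewrite -expnSr prednK // sq_deg_gt0.
have := @cnt_shift F d _ (fun w : 'rV[F]_n => bform d l m w) A C (#|F| ^ n.-1).
rewrite card_mx mul1n en mulnA mulnAC leq_pmul2r ?expn_gt0 ?q0 //; apply.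
- by move=> w; apply: bform_homog.
- by move=> f w hf /andP[]; rewrite invC.
move=> f hf Cf; rewrite -(leq_pmul2r q0) -en.
apply: leq_trans (card_has_sq_shift r (rest P Q f)); rewrite leq_mul2r; apply/orP; right.
apply/subset_leq_card/subsetP => w; rewrite !inE => /andP[_].
by rewrite rmorphD /= (rest_bform d _ dPQ).
Qed.

(** * The line z = 0 and the pencils of lines through its points *)

Definition vec3 (x y z : F) : 'rV[F]_3 := \row_i nth 0 [:: x; y; z] i.

Lemma dot_vec3 x y z x' y' z' :
  dot (vec3 x y z) (vec3 x' y' z') = x * x' + y * y' + z * z'.
Proof. by rewrite /dot !big_ord_recl big_ord0 !mxE /= addr0 addrA. Qed.

Lemma vec3_comb b x y z x' y' z' :
  b *: vec3 x y z + vec3 x' y' z' = vec3 (b * x + x') (b * y + y') (b * z + z').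
Proof. by apply/rowP => -[[|[|[|i]]] lt_i]; rewrite !mxE. Qed.

Local Notation e0 := (vec3 1 0 0).
Local Notation e1 := (vec3 0 1 0).
Local Notation e2 := (vec3 0 0 1).

(* The points of the line z = 0, completed to a basis of F^3 by a further point
   of that line and e2, together with the dual basis [lam o], [mu o], e2. *)
Definition pt (o : option F) := if o is Some b then vec3 1 b 0 else e1.
Definition pt' (o : option F) := if o is Some b then e1 else e0.
Definition lam (o : option F) := if o is Some b then e0 else e1.
Definition mu (o : option F) := if o is Some b then vec3 (- b) 1 0 else e0.

(** As [a] varies these are the [q] lines through [pt o] other than z = 0. The form [mu o] has value
    [a] at the second basis point and so tells the lines apart. *)
Lemma dual_pencil o a : dual (pt o) (a *: pt' o + e2) (lam o) e2 /\
  dot (mu o) (pt o) = 0 /\ dot (mu o) (a *: pt' o + e2) = a.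
Proof.
by case: o => [b|]; rewrite /dual /pt /pt' /lam /mu !vec3_comb !dot_vec3; split;
   repeat split; ring.
Qed.

Lemma ev_pt d f o : f \is d.-homog ->
  ev f (pt o) = if o is Some b then (rest e1 e0 f).[b] else (rest e1 e0 f)`_d.
Proof.
move=> hf; case: o => [b|]; last by rewrite (coef_rest_top _ _ hf).
by rewrite horner_rest vec3_comb; congr (ev f (vec3 _ _ _)); ring.
Qed.

Lemma ev_pt_shift d f g o : f \is d.-homog -> g \is d.-homog ->
  rest e1 e0 g = 0 -> ev (f + g) (pt o) = ev f (pt o).
Proof.
move=> hf hg g0; rewrite !(@ev_pt d) ?rpredD // rmorphD /= g0 addr0 //.
Qed.

Lemma row_free_pencil o a : row_free (col_mx (pt o) (a *: pt' o + e2)).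
Proof. by apply/row_free_dual; exists (lam o), e2; case: (dual_pencil o a). Qed.

Lemma dual_e1e0 : dual e1 e0 e1 e0.
Proof. by rewrite /dual !dot_vec3; split; ring. Qed.

Lemma dual_e1e2 : dual e1 e2 e1 e2.
Proof. by rewrite /dual !dot_vec3; split; ring. Qed.

Lemma rest_e2_l0 d n l (w : 'rV[F]_n) : (n <= d)%N -> rest e1 e0 (bform d l e2 w) = 0.
Proof. by move=> le_n; apply: rest_bform0 => //; rewrite dot_vec3; ring. Qed.

(** Lagrange interpolation in the pencil parameter, made homogeneous by [lin e2]: it restricts to
    [1] on the line [a] and to [0] on the others. *)
Definition lagrange o (a : F) : {mpoly F[3]} :=
  \prod_(b in [pred b | b != a]) ((a - b)^-1 *: (lin (mu o) - b *: lin e2)).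

Lemma lagrange_homog o a : lagrange o a \is (#|F|.-1).-homog.
Proof.
have -> : #|F|.-1 = (\sum_(b in [pred b | b != a]) 1)%N.
  by rewrite sum1_card cardC1.
rewrite /lagrange; elim/big_rec2: _ => [|b n p _ hp]; first exact: dhomog1.
apply: homogM hp (erefl _); apply: dhomogZ.
by rewrite rpredB ?lin_homog // dhomogZ // lin_homog.
Qed.

Lemma rest_lagrange o a c : rest (pt o) (c *: pt' o + e2) (lagrange o a) = (a == c)%:R.
Proof.
have [[_ _ nP nQ] [mP mQ]] := dual_pencil o c.
have factor b : rest (pt o) (c *: pt' o + e2)
    ((a - b)^-1 *: (lin (mu o) - b *: lin e2)) = ((a - b)^-1 * (c - b))%:P.
  rewrite restZ rmorphB /= restZ !rest_lin mP mQ nP nQ -!mul_polyC; ring.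
rewrite /lagrange rmorph_prod /=; under eq_bigr => b _ do rewrite factor.
rewrite -rmorph_prod /=; have [<-|neq] := eqVneq a c.
  rewrite big1 // => b; rewrite inE => neq; rewrite mulVf // subr_eq0 eq_sym //.
rewrite (bigD1 c) /=; last by rewrite inE eq_sym.
by rewrite subrr mulr0 mul0r.
Qed.

(** Prescribes independent perturbations on the [q] lines of the pencil, while its factor [lin e2]
    leaves the line z = 0 untouched. *)
Definition pencil_form d n o (h : {ffun F -> 'rV[F]_n}) : {mpoly F[3]} :=
  \sum_(a : F) lagrange o a * bform (d - #|F|.-1) (lam o) e2 (h a).

Lemma pencil_form_homog d n o (h : {ffun F -> 'rV[F]_n}) : (n + #|F| <= d)%N ->
  pencil_form d o h \is d.-homog.
Proof.
move=> le_d; apply: rpred_sum => a _.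
by apply: homogM (lagrange_homog _ _) (bform_homog _ _ _ _) _; lia.
Qed.

Lemma rest_pencil_form d n o (h : {ffun F -> 'rV[F]_n}) c :
  rest (pt o) (c *: pt' o + e2) (pencil_form d o h) = rVpoly (h c).
Proof.
rewrite /pencil_form rmorph_sum /= (bigD1 c) //= big1 ?addr0 => [|a neq].
  by rewrite rmorphM /= rest_lagrange eqxx mul1r (rest_bform _ _ (dual_pencil o c).1).
by rewrite rmorphM /= rest_lagrange (negPf neq) mul0r.
Qed.

Lemma rest_pencil_form_l0 d n o (h : {ffun F -> 'rV[F]_n}) : (n + #|F| <= d)%N ->
  rest e1 e0 (pencil_form d o h) = 0.
Proof.
move=> le_d; have le_n : (n <= d - #|F|.-1)%N by lia.
rewrite /pencil_form rmorph_sum /= big1 // => a _.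
by rewrite rmorphM /= (rest_e2_l0 _ _ le_n) mulr0.
Qed.

Lemma card_ffun_forall (T U : finType) (P : T -> pred U) K :
  (forall t, (#|[set u | P t u]| <= K)%N) ->
  (#|[set h : {ffun T -> U} | [forall t, P t (h t)]]| <= K ^ #|T|)%N.
Proof.
move=> boundK; have -> : #|[set h : {ffun T -> U} | [forall t, P t (h t)]]|
    = #|family (fun t => [pred u | P t u])|.
  by apply: eq_card => h; rewrite inE; apply/forallP/familyP.
rewrite card_family foldrE big_map big_enum -prod_nat_const /=.
apply: leq_prod => t _; apply: leq_trans (boundK t); rewrite cardsE //.
Qed.

(** Here [v] is the number of all forms and [Q] stands for [q^q]. The hypotheses give
    [T <= v (1/q + 1/q^2 - 1/q^3)] and [B <= C (2/q - 1/q^2)]. Setting [q = p.+1] and clearing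
    denominators avoids subtraction. *)
Lemma combine_case_bounds (q Q T C v A B z s x y : nat) : (1 < q)%N ->
  (T <= z + s)%N -> (z * q ^ 2 <= v)%N -> (s * q + z <= v)%N ->
  (B <= x + y)%N -> (y * q <= C)%N -> (x * q + y <= C)%N ->
  (A * Q <= T)%N -> (C * (q * Q) <= v)%N ->
  ((B + A) * (q * Q) <= 2 * v)%N.
Proof.
case: q => // p p1 h1 h2 h3 k1 k2 k3 hA hC.
have a1 : (A * (p.+1 * Q) <= p * z + v)%N.
  have : (p.+1 * (A * Q) <= p.+1 * (z + s))%N by rewrite leq_mul2l (leq_trans hA).
  by rewrite mulnCA; move: h3; rewrite (mulnC s) mulnDr !mulSn; lia.
have a2 : (A * (p.+1 * Q) * p.+1 ^ 2 <= p * v + v * p.+1 ^ 2)%N.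
  apply: (leq_trans (leq_mul a1 (leqnn _))); rewrite mulnDl leq_add2r -mulnA.
  by rewrite leq_mul2l h2 orbT.
have b1 : (B * p.+1 ^ 2 <= (p.*2).+1 * C)%N.
  have : (B * p.+1 <= p * y + C)%N.
    have : (p.+1 * B <= p.+1 * (x + y))%N by rewrite leq_mul2l k1.
    by rewrite (mulnC B); move: k3; rewrite (mulnC x) mulnDr !mulSn; lia.
  rewrite -(leq_pmul2r (ltn0Sn p)) => le1; rewrite -mulnn mulnA; apply: (leq_trans le1).
  have : (p * (y * p.+1) <= p * C)%N by rewrite leq_mul2l k2 orbT.
  rewrite mulnDl mulnA (mulnC C) -mul2n !mulSn -mulnA => le2; lia.
have b2 : (B * (p.+1 * Q) * p.+1 ^ 2 <= (p.*2).+1 * v)%N.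
  rewrite mulnAC; apply: (leq_trans (leq_mul b1 (leqnn _))).
  by rewrite -mulnA leq_mul2l hC orbT.
rewrite -(leq_pmul2r (_ : 0 < p.+1 ^ 2)%N) ?expn_gt0 //.
rewrite (mulnDl B A) (mulnDl (B * _)).
apply: (leq_trans (leq_add b2 a2)).
rewrite addnA -mulnDl (mulnC v) -mulnDl [leqRHS]mulnAC leq_mul2r; apply/orP; right.
(* What remains is [3 p + 1 <= (p + 1)^2], that is, [(q - 1) (q - 2) >= 0]. *)
by rewrite -mulnn; nia.
Qed.

(** * The estimates in a fixed large degree *)

Section FixedDegree.
Variables d r : nat.
Hypotheses (r_gt0 : (0 < r)%N) (d_large : (sq_deg F r + #|F| < d)%N).

Let d_gt0 : (0 < d)%N. Proof. by apply: leq_trans d_large. Qed.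
Let q_gt1 : (1 < #|F|)%N. Proof. exact: card_finField_gt1. Qed.

(** For a form of degree [d]: multiplicity at least [2] at [P] on the line through [P] and [Q]. *)
Definition top_zero f P Q := ((rest P Q f)`_d == 0) && ((rest P Q f)`_d.-1 == 0).

Lemma tangent_upto_cases f P Q : f \is d.-homog -> tangent_upto r f P Q ->
  top_zero f P Q || has_sq r (rest P Q f).
Proof.
move=> hf /orP[->|]; first by rewrite orbT.
move=> /(has_sq_rev hf d_gt0)[->|[c0 c1]]; first by rewrite orbT.
by rewrite /top_zero c0 c1 !eqxx.
Qed.

Lemma coef_bform_high P Q l m n (w : 'rV[F]_n) j : dual P Q l m -> (n <= j)%N ->
  (rest P Q (bform d l m w))`_j = 0.
Proof.
move=> dPQ le_j; rewrite (rest_bform _ _ dPQ) nth_default //.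
by apply: leq_trans le_j; apply: size_poly.
Qed.

(** [Phi] shifts the two top coefficients independently, and at most one shift makes both vanish. *)
Lemma cnt_top_zero : (cnt d (fun f => top_zero f e1 e0) * #|F| ^ 2 <= @cnt F d xpredT)%N.
Proof.
pose Phi (u : F * F) := u.1 *: lin e1 ^+ d + u.2 *: (lin e1 ^+ d.-1 * lin e0).
have restPhi u : rest e1 e0 (Phi u) = u.1 *: 'X^d + u.2 *: 'X^(d.-1).
  have [aP aQ bP bQ] := dual_e1e0.
  rewrite /Phi rmorphD /= !restZ rmorphM !rmorphXn /= !rest_lin aP aQ bP bQ.
  by rewrite mul0r add0r mul1r addr0 mulr1.
have := @cnt_shift F d _ Phi (fun f => top_zero f e1 e0) xpredT 1.
rewrite card_prod muln1 mulnn; apply => //.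
  move=> u; apply: rpredD; apply: dhomogZ; first exact: linX_homog.
  by apply: homogM (linX_homog _ _) (lin_homog _) _; rewrite addn1 prednK.
move=> f hf _; apply: card_le1_inj.
have d1 : (d == d.-1) = false by apply/negbTE; lia.
have key u : top_zero (f + Phi u) e1 e0 ->
    (rest e1 e0 f)`_d + u.1 = 0 /\ (rest e1 e0 f)`_d.-1 + u.2 = 0.
  rewrite /top_zero [rest _ _ (_ + _)](rmorphD (rest e1 e0) f (Phi u)) /= restPhi.
  rewrite !coefD !coefZ !coefXn !eqxx d1 [d.-1 == d]eq_sym d1 !mulr0 !mulr1 addr0 add0r.
  by case/andP => /eqP-> /eqP->.
move=> [u1 u2] [v1 v2]; rewrite !inE => /key[/= a1 a2] /key[/= b1 b2].
by congr (_, _); [apply: (addrI (rest e1 e0 f)`_d); rewrite a1 b1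
  | apply: (addrI (rest e1 e0 f)`_d.-1); rewrite a2 b2].
Qed.

(** [z] counts the double zeros at [e1] and [s] the remaining forms with a square factor.
    Conditioning [s] on the complement of [z] saves a second-order term, which the final estimate
    requires at [q = 2]. *)
Lemma cnt_tangent_l0 : exists z s : nat,
  [/\ (cnt d (fun f => tangent_upto r f e1 e0) <= z + s)%N,
      (z * #|F| ^ 2 <= @cnt F d xpredT)%N & (s * #|F| + z <= @cnt F d xpredT)%N].
Proof.
exists (cnt d (fun f => top_zero f e1 e0)),
  (cnt d (fun f => ~~ top_zero f e1 e0 && has_sq r (rest e1 e0 f))).
split; last 2 first.
- exact: cnt_top_zero.
- rewrite (cnt_predC d xpredT (fun f => top_zero f e1 e0)) addnC leq_add2l.
  apply: (cnt_has_sq r_gt0 _ dual_e1e0); first lia.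
  move=> f w hf; rewrite /top_zero rmorphD /= !coefD.
  by rewrite !(coef_bform_high _ dual_e1e0) ?addr0 //; lia.
apply: leq_trans (cnt_predU _ _ _); apply: leq_cnt => f hf /(tangent_upto_cases hf).
by case: (top_zero _ _ _).
Qed.

Definition all_vanish f := [forall o, ev f (pt o) == 0].

(** The values at the [q] affine points and at infinity are shifted independently: a polynomial with
    [q] coefficients is determined by its values on [F], and ['X^d] alone controls the top
    coefficient. *)
Lemma cnt_all_vanish : (cnt d all_vanish * #|F| ^ #|F|.+1 <= @cnt F d xpredT)%N.
Proof.
set q := #|F|.
pose Phi (u : 'rV[F]_q * F) := bform d e1 e0 u.1 + u.2 *: lin e1 ^+ d.
have restPhi u : rest e1 e0 (Phi u) = rVpoly u.1 + u.2 *: 'X^d.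
  have [aP aQ bP bQ] := dual_e1e0.
  rewrite /Phi rmorphD /= (rest_bform _ _ dual_e1e0) restZ rmorphXn /= rest_lin aP aQ.
  by rewrite mul1r addr0.
have hPhi u : Phi u \is d.-homog.
  apply: rpredD; last by apply: dhomogZ; apply: linX_homog.
  by apply: bform_homog; lia.
have := @cnt_shift F d _ Phi all_vanish xpredT 1.
rewrite card_prod card_mx mul1n muln1 -expnSr; apply => //.
move=> f hf _; apply: card_le1_inj.
move=> [w u] [w' u']; rewrite !inE => /forallP vu /forallP vu'.
have top (x : 'rV[F]_q) : (rVpoly x)`_d = 0.
  by rewrite nth_default // (leq_trans (size_poly _ _)) //; lia.
have restD v : rest e1 e0 (f + Phi v) = rest e1 e0 f + (rVpoly v.1 + v.2 *: 'X^d).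
  by rewrite (rmorphD (rest e1 e0) f (Phi v)) /= restPhi.
have hD v : f + Phi v \is d.-homog by exact: rpredD hf (hPhi v).
have eqo o : ev (f + Phi (w, u)) (pt o) = ev (f + Phi (w', u')) (pt o).
  by rewrite (eqP (vu o)) (eqP (vu' o)).
have eu : u = u'.
  have := eqo None; rewrite !(ev_pt None (hD _)) !restD !coefD !top !coefZ.
  by rewrite coefXn eqxx !mulr1 !add0r => /addrI.
congr (_, _) => //; apply: (can_inj (@rVpolyK F q)); apply/eqP; rewrite -subr_eq0.
apply/eqP; apply: (@roots_geq_poly_eq0 _ _ (enum F)).
- apply/allP => b _; rewrite rootE hornerD hornerN subr_eq0; apply/eqP.
  have := eqo (Some b); rewrite !(ev_pt (Some b) (hD _)) !restD !hornerD /= eu.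
  by move=> /addrI /addIr.
- exact: enum_uniq.
rewrite -cardE -linearB; exact: size_poly.
Qed.

(** The choice depends only on the values of [f] on the line z = 0, so [pencil_form] preserves it;
    it partitions the forms that are not [all_vanish]. *)
Definition pick_pt f := [pick o | ev f (pt o) != 0].

(** Since [f] does not vanish at [pt o], no line through it has a double zero there, and tangency
    forces a square factor in the first chart. The [q] restrictions are shifted independently, each
    giving a factor [1/q]. *)
Lemma cnt_pencil o :
  (cnt d (fun f => tangent_all r f && (pick_pt f == Some o)) * #|F| ^ #|F|
   <= cnt d (fun f => tangent_upto r f e1 e0 && (pick_pt f == Some o)))%N.
Proof.
set A := fun f => _; set C := fun f => _; set n := sq_deg F r.
have en : (#|F| ^ n = #|F| ^ n.-1 * #|F|)%N by rewrite -expnSr prednK // sq_deg_gt0.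
have := @cnt_shift F d _ (fun h : {ffun F -> 'rV[F]_n} => pencil_form d o h) A C
  ((#|F| ^ n.-1) ^ #|F|).
have hh (h : {ffun F -> 'rV[F]_n}) : pencil_form d o h \is d.-homog.
  by apply: pencil_form_homog; exact: ltnW.
have rest0 (h : {ffun F -> 'rV[F]_n}) : rest e1 e0 (pencil_form d o h) = 0.
  by apply: rest_pencil_form_l0; exact: ltnW.
have pick_sh f (h : {ffun F -> 'rV[F]_n}) : f \is d.-homog -> pick_pt (f + pencil_form d o h) = pick_pt f.
  by move=> hf; apply: eq_pick => o' /=; rewrite (ev_pt_shift _ hf (hh h) (rest0 h)).
have q0 : (0 < #|F|)%N by apply: ltnW.
rewrite card_ffun card_mx mul1n en expnMn mulnA mulnAC leq_pmul2r ?expn_gt0 ?q0 //; apply => //.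
  move=> f h hf /andP[/tangent_allP tf]; rewrite pick_sh // /C => ->; rewrite andbT.
  have := tf e1 e0; rewrite /tangent_upto !rmorphD /= rest0 addr0.
  (* The shift vanishes in the opposite chart too, so tangency to z = 0 passes back to [f]. *)
  rewrite (rest_rev e1 e0 (hh h)) rest0 /rev_poly big1 => [|i _]; last by rewrite coef0 scale0r.
  rewrite addr0; apply; apply/row_free_dual; exists e1, e0; exact: dual_e1e0.
move=> f hf Cf.
apply: leq_trans (@card_ffun_forall _ _ (fun a (w : 'rV[F]_n) =>
   has_sq r (rest (pt o) (a *: pt' o + e2) f + rVpoly w)) _ _); last first.
  by move=> a; rewrite -(leq_pmul2r q0) -en card_has_sq_shift.
apply/subset_leq_card/subsetP => h; rewrite !inE => /andP[/tangent_allP tf].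
rewrite pick_sh // => /eqP; rewrite /pick_pt; case: pickP => // o' nz [eo].
rewrite {}eo in nz; apply/forallP => a.
have hfh : f + pencil_form d o h \is d.-homog by exact: rpredD hf (hh h).
have := tangent_upto_cases hfh (tf _ _ (row_free_pencil o a)).
rewrite /top_zero (coef_rest_top _ _ hfh) (ev_pt_shift _ hf (hh h) (rest0 h)) (negPf nz) /=.
by rewrite rmorphD /= rest_pencil_form.
Qed.

Lemma cnt_tangent_some_nonvanish :
  (cnt d (fun f => tangent_all r f && ~~ all_vanish f) * #|F| ^ #|F|
   <= cnt d (fun f => tangent_upto r f e1 e0))%N.
Proof.
have part (A : pred {mpoly F[3]}) :
   (cnt d (fun f => A f && ~~ all_vanish f)
     = \sum_o cnt d (fun f => A f && (pick_pt f == Some o)))%N.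
  rewrite /cnt -sum1_card.
  under [RHS]eq_bigr => o _ do rewrite -sum1_card big_mkcond.
  rewrite exchange_big [LHS]big_mkcond; apply: eq_bigr => c _; rewrite inE.
  set f := poly_of_coefs c; case Af: (A f) => /=; last first.
    by rewrite big1 // => o _; rewrite inE -/f Af.
  rewrite /all_vanish negb_forall /pick_pt.
  under [RHS]eq_bigr => o _ do rewrite inE -/f Af /=.
  case: pickP => [o0 nz|none].
    rewrite (bigD1 o0) //= eqxx big1 ?addn0 => [|o neq].
      by rewrite (_ : [exists x, _]) //; apply/existsP; exists o0.
    by case: eqP => // -[e]; rewrite e eqxx in neq.
  rewrite big1 // (_ : [exists x, _] = false) //.
  by apply/negbTE/existsPn => o; rewrite none.
rewrite part big_distrl /=.
apply: (@leq_trans (cnt d (fun f => tangent_upto r f e1 e0 && ~~ all_vanish f))).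
  by rewrite part; apply: leq_sum => o _; apply: cnt_pencil.
by apply: leq_cnt => f _ /andP[].
Qed.

(** The further line joins [e1] to [e2]. The form vanishes at [e1], so a double zero there is the
    single condition [Z], counted by [y]; [x] counts square factors given that [Z] fails. All shifts
    are multiples of [lin e2] and preserve [all_vanish]. *)
Lemma cnt_tangent_all_vanish : exists x y : nat,
  [/\ (cnt d (fun f => tangent_all r f && all_vanish f) <= x + y)%N,
      (y * #|F| <= cnt d all_vanish)%N & (x * #|F| + y <= cnt d all_vanish)%N].
Proof.
pose Z f := (rest e1 e2 f)`_d.-1 == 0.
have inv f g : f \is d.-homog -> g \is d.-homog -> rest e1 e0 g = 0 ->
    all_vanish (f + g) = all_vanish f.
  by move=> hf hg g0; apply: eq_forallb => o; rewrite (ev_pt_shift _ hf hg g0).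
exists (cnt d (fun f => (all_vanish f && ~~ Z f) && has_sq r (rest e1 e2 f))),
  (cnt d (fun f => all_vanish f && Z f)); split; last 2 first.
- pose Phi (u : F) := u *: (lin e1 ^+ d.-1 * lin e2).
  have hPhi u : Phi u \is d.-homog.
    by apply: dhomogZ; apply: homogM (linX_homog _ _) (lin_homog _) _; rewrite addn1 prednK.
  have Phi0 u : rest e1 e0 (Phi u) = 0.
    rewrite /Phi restZ rmorphM /= [rest _ _ (lin e2)]rest_lin !dot_vec3.
    by rewrite !(mulr0, mul0r, addr0, polyC0, scaler0).
  have := @cnt_shift F d _ Phi (fun f => all_vanish f && Z f) all_vanish 1.
  rewrite muln1; apply => //.
    by move=> f u hf /andP[]; rewrite inv.
  move=> f hf _; apply: card_le1_inj.
  have restPhi u : (rest e1 e2 (Phi u))`_d.-1 = u.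
    have [aP aQ bP bQ] := dual_e1e2.
    rewrite /Phi restZ rmorphM rmorphXn /= !rest_lin aP aQ bP bQ.
    by rewrite mul0r add0r mul1r addr0 mulr1 coefZ coefXn eqxx mulr1.
  move=> u v; rewrite !inE => /andP[_ /eqP] + /andP[_ /eqP].
  rewrite !rmorphD /= !coefD !restPhi => a1 a2.
  by apply: (addrI (rest e1 e2 f)`_d.-1); rewrite a1 a2.
- rewrite (cnt_predC d all_vanish Z) addnC leq_add2l.
  apply: (cnt_has_sq r_gt0 _ dual_e1e2); first lia.
  move=> f w hf; rewrite inv //; last by apply: rest_e2_l0; lia.
    by rewrite /Z rmorphD /= coefD (coef_bform_high _ dual_e1e2) ?addr0 //; lia.
  by apply: bform_homog; lia.
apply: leq_trans (cnt_predU _ _ _); apply: leq_cnt => f hf /andP[/tangent_allP tf av].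
have /(tf e1 e2)/(tangent_upto_cases hf) : row_free (col_mx e1 e2).
  by apply/row_free_dual; exists e1, e2; apply: dual_e1e2.
rewrite av /= /top_zero -/(Z f); case: (Z f); rewrite ?orbT // andbF /= => ->.
by [].
Qed.

Lemma cnt_tangent_all :
  (cnt d (tangent_all r) * #|F| ^ #|F|.+1 <= 2 * @cnt F d xpredT)%N.
Proof.
rewrite (cnt_predC d (tangent_all r) all_vanish) expnS.
have [z [s [h1 h2 h3]]] := cnt_tangent_l0.
have [x [y [k1 k2 k3]]] := cnt_tangent_all_vanish.
have hC := cnt_all_vanish; rewrite expnS in hC.
exact: (combine_case_bounds q_gt1 h1 h2 h3 k1 k2 k3 cnt_tangent_some_nonvanish hC).
Qed.

End FixedDegree.
End UpperBound.

(** * Eventual constancy of the truncated proportion *)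

Section Stability.
Variable F : finFieldType.
Implicit Types (f g : {mpoly F[3]}) (P Q : 'rV[F]_3) (d r : nat).

Lemma tangent_all_le r r' f : (r <= r')%N -> tangent_all r f -> tangent_all r' f.
Proof.
move=> le_r /tangent_allP tf; apply/tangent_allP => P Q /tf /orP[] sq.
  by rewrite /tangent_upto (has_sq_le le_r sq).
by rewrite /tangent_upto (has_sq_le le_r sq) orbT.
Qed.

Lemma row_free_swap P Q : row_free (col_mx P Q) -> row_free (col_mx Q P).
Proof.
by move=> /row_free_dual[l [m dlm]]; apply/row_free_dual; exists m, l; apply: dual_sym.
Qed.

(** With [d.+1] free coefficients the restriction is uniformly distributed, which reduces the count
    to univariate polynomials. *)
Lemma cnt_tail_line d r P Q : (0 < r)%N -> row_free (col_mx P Q) ->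
  (cnt d (fun f => has_sq d (rest P Q f) && ~~ has_sq r (rest P Q f)) * #|F| ^ r
     <= @cnt F d xpredT)%N.
Proof.
move=> r0 /row_free_dual[l [m dlm]]; set A := fun f => _.
pose S := [set v : 'rV[F]_(d.+1) | has_sq d (rVpoly v) && ~~ has_sq r (rVpoly v)].
have := @cnt_shift F d _ (fun w : 'rV[F]_d.+1 => bform d l m w) A xpredT #|S|.
rewrite card_mx mul1n => h.
have {}h : (cnt d A * #|F| ^ d.+1 <= @cnt F d xpredT * #|S|)%N.
  apply: h => // [w|f hf _]; first exact: bform_homog.
  pose X (g : {poly F}) := has_sq d g && ~~ has_sq r g.
  rewrite -(card_rV_translate X (size_rest P Q hf)).
  by apply/subset_leq_card/subsetP => w; rewrite !inE /A rmorphD /= (rest_bform d _ dlm).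
have q0 : (0 < #|F| ^ d.+1)%N by rewrite expn_gt0 (ltnW (card_finField_gt1 F)).
rewrite -(leq_pmul2r q0) mulnAC; apply: (leq_trans (leq_mul h (leqnn _))).
by rewrite -mulnA leq_mul2l (card_has_sq_tail F d r0) orbT.
Qed.

(** A union bound over ordered pairs of vectors, of which there are [#|F| ^ 6]; swapping the pair
    accounts for the second chart. *)
Lemma cnt_tail d r : (0 < r)%N ->
  (cnt d (fun f => tangent_all d f && ~~ tangent_all r f) * #|F| ^ r
     <= #|F| ^ 6 * @cnt F d xpredT)%N.
Proof.
move=> r0.
pose B (x : 'rV[F]_3 * 'rV[F]_3) f := row_free (col_mx x.1 x.2) &&
  (has_sq d (rest x.1 x.2 f) && ~~ has_sq r (rest x.1 x.2 f)).
have le1 : (cnt d (fun f => tangent_all d f && ~~ tangent_all r f)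
            <= \sum_x cnt d (B x))%N.
  have -> : (\sum_x cnt d (B x) = \sum_(c : {ffun mon d -> F}) \sum_x B x (poly_of_coefs c))%N.
    rewrite exchange_big; apply: eq_bigr => x _; rewrite /cnt -sum1_card big_mkcond.
    by apply: eq_bigr => c _; rewrite inE; case: (B _ _).
  rewrite /cnt -sum1_card big_mkcond; apply: leq_sum => c _; rewrite inE.
  set f := poly_of_coefs c; case: ifP => // /andP[/tangent_allP td].
  rewrite /tangent_all negb_forall => /existsP[P]; rewrite negb_forall => /existsP[Q].
  rewrite negb_imply => /andP[rf]; rewrite negb_or => /andP[n1 n2].
  have [x Bx] : exists x, B x f.
    have /orP[s1|s2] := td _ _ rf; first by exists (P, Q); rewrite /B rf s1 n1.
    by exists (Q, P); rewrite /B (row_free_swap rf) s2 n2.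
  by rewrite (bigD1 x) //= Bx.
apply: (leq_trans (leq_mul le1 (leqnn _))); rewrite big_distrl /=.
have -> : (#|F| ^ 6 * @cnt F d xpredT = \sum_(x : 'rV[F]_3 * 'rV[F]_3) @cnt F d xpredT)%N.
  by rewrite sum_nat_const card_prod !card_mx -expnD.
apply: leq_sum => -[P Q] _; have [rf|nrf] := boolP (row_free (col_mx P Q)); last first.
  rewrite (_ : cnt d _ = 0%N) //; apply: eq_card0 => c.
  by rewrite inE /B /= (negPf nrf).
rewrite (eq_cnt (B := fun f => has_sq d (rest P Q f) && ~~ has_sq r (rest P Q f))).
  exact: cnt_tail_line.
by move=> f _; rewrite /B /= rf.
Qed.

(** * Residues of forms on all lines *)

Section FixedBound.
Variable r : nat.

Local Notation M := (sq_modulus F r).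
Local Notation n := (sq_deg F r).
Local Notation W := {ffun 'rV[F]_3 * 'rV[F]_3 -> 'rV[F]_n}.
Local Notation N := (unit_exponent F r).

Definition residues f : W :=
  [ffun x => if row_free (col_mx x.1 x.2) then poly_rV (rest x.1 x.2 f %% M) else 0].

Lemma residuesD f g : residues (f + g) = residues f + residues g.
Proof.
apply/ffunP => x; rewrite !ffunE; case: ifP => _; last by rewrite addr0.
by rewrite rmorphD /= modpD linearD.
Qed.

Definition tangent_res (w : W) :=
  [forall P : 'rV[F]_3, forall Q : 'rV[F]_3, row_free (col_mx P Q) ==>
     (has_sq r (rVpoly (w (P, Q))) || has_sq r (rVpoly (w (Q, P))))].

Lemma tangent_residues f : tangent_res (residues f) = tangent_all r f.
Proof.
apply: eq_forallb => P; apply: eq_forallb => Q.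
have [rf|//] := boolP (row_free _).
by rewrite !ffunE /= rf (row_free_swap rf) !poly_rV_K ?size_mod_sq // !has_sq_mod.
Qed.

Definition mform e : {mpoly F[3]} :=
  multiplier N e 'X_(@Ordinal 3 0 isT) 'X_(@Ordinal 3 1 isT) 'X_(@Ordinal 3 2 isT).

Lemma mform_homog e : (N.*2 < e)%N -> mform e \is e.-homog.
Proof.
move=> lt_e; have hX (i : 'I_3) k : ('X_i : {mpoly F[3]}) ^+ k \is k.-homog.
  by rewrite -{2}[k]mul1n; apply: homogX; rewrite dhomogX /= mdeg1.
have hB (i j : 'I_3) k : ('X_i : {mpoly F[3]}) ^+ k - 'X_j ^+ k \is k.-homog.
  exact: rpredB (hX i k) (hX j k).
have h1 (i j : 'I_3) : ('X_i : {mpoly F[3]}) ^+ (e - N) * ('X_i ^+ N - 'X_j ^+ N) \is e.-homog.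
  by apply: homogM (hX _ _) (hB _ _ _) _; lia.
have h2 (i j k : 'I_3) : ('X_i : {mpoly F[3]}) ^+ (e - N.*2) * ('X_i ^+ N - 'X_j ^+ N)
    * ('X_i ^+ N - 'X_k ^+ N) \is e.-homog.
  by apply: homogM (homogM (hX _ _) (hB _ _ _) (erefl _)) (hB _ _ _) _; lia.
exact: rpredD (rpredD (hX _ _) (h1 _ _)) (h2 _ _ _).
Qed.

(** An irreducible dividing the restrictions of all three coordinates would divide that of [lin m],
    which is [1]. *)
Lemma coprime_mform e P Q : (N.*2 < e)%N -> row_free (col_mx P Q) ->
  coprimep M (rest P Q (mform e)).
Proof.
move=> lt_e /row_free_dual[l [m [_ _ mP mQ]]]; apply: coprimep_sq_modulus => p irr szp.
rewrite /mform (rmorph_multiplier (rest P Q)).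
apply: irreducible_ndvd_multiplier => //; apply/negP => /and3P[d0 d1 d2].
have : p %| rest P Q (lin m).
  rewrite /lin rmorph_sum /=; elim/big_ind: _ => [|? ?|i _].
  - exact: dvdp0.
  - exact: dvdp_add.
  rewrite restZ -mul_polyC dvdp_mull //.
  by case: i => -[|[|[|//]]] lt_i; rewrite (bool_irrelevance lt_i isT).
rewrite rest_lin mP mQ mul0r add0r dvdp1; case: irr => + _.
by case: (size p) => [|[|]].
Qed.

Definition mulW e (w : W) : W :=
  [ffun x => if row_free (col_mx x.1 x.2)
             then poly_rV ((rVpoly (w x) * rest x.1 x.2 (mform e)) %% M) else 0].

Lemma residues_mulW e f : residues (f * mform e) = mulW e (residues f).
Proof.
apply/ffunP => x; rewrite !ffunE; case: ifP => // _.
by rewrite poly_rV_K ?size_mod_sq // rmorphM /= mulrC [in RHS]mulrC modp_mul.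
Qed.

Lemma tangent_res_mulW e w : (N.*2 < e)%N -> tangent_res (mulW e w) = tangent_res w.
Proof.
move=> lt_e; apply: eq_forallb => P; apply: eq_forallb => Q.
have [rf|//] := boolP (row_free _).
rewrite !ffunE /= rf (row_free_swap rf) !poly_rV_K ?size_mod_sq // !has_sq_mod.
by rewrite !has_sqM_coprime // coprime_mform // row_free_swap.
Qed.

(** The restriction of [mform e] is a unit modulo [M] on every line. *)
Lemma mulW_inj e f g : (N.*2 < e)%N ->
  mulW e (residues f) = mulW e (residues g) -> residues f = residues g.
Proof.
move=> lt_e eq_m; apply/ffunP => x; move/ffunP/(_ x): eq_m; rewrite !ffunE.
case: ifP => // rf /(congr1 rVpoly); rewrite !poly_rV_K ?size_mod_sq // => eq_m.
congr poly_rV; apply/eqP; rewrite -subr_eq0 -modpN -modpD; apply/eqP/modp_eq0P.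
have co := coprime_mform lt_e rf.
rewrite -(Gauss_dvdpl _ co) mulrBl; apply/modp_eq0P.
apply/eqP; rewrite modpD modpN subr_eq0; apply/eqP.
have modl (a b : {poly F}) : (a %% M * b) %% M = (a * b) %% M.
  by rewrite mulrC modp_mul mulrC.
by move: eq_m; rewrite !rf !poly_rV_K ?size_mod_sq // !modl.
Qed.

Definition image_res d : {set W} :=
  [set residues (poly_of_coefs c) | c : {ffun mon d -> F}].

Definition kernel_res d := #|[set c : {ffun mon d -> F} | residues (poly_of_coefs c) == 0]|.

(** Taking residues is additive, so each nonempty fibre is a translate of the kernel. *)
Lemma card_fiber d w : w \in image_res d ->
  #|[set c : {ffun mon d -> F} | residues (poly_of_coefs c) == w]| = kernel_res d.
Proof.
case/imsetP => c0 _ ->; rewrite /kernel_res -[RHS](card_imset _ (addrI c0)).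
apply: eq_card => c; rewrite [LHS]inE; apply/eqP/imsetP => [e|[k]].
  exists (c - c0); last by rewrite addrC subrK.
  rewrite inE; apply/eqP; apply: (addrI (residues (poly_of_coefs c0))).
  by rewrite -residuesD -poly_of_coefsD addrC subrK addr0.
by rewrite inE => /eqP ek ->; rewrite poly_of_coefsD residuesD ek addr0.
Qed.

Lemma cnt_residues d (X : pred W) :
  cnt d (fun f => X (residues f)) = (#|[set w in image_res d | X w]| * kernel_res d)%N.
Proof.
rewrite -sum_nat_const /cnt -sum1_card.
rewrite (partition_big (fun c => residues (poly_of_coefs c))
   (mem [set w in image_res d | X w])) /=; last first.
  by move=> c; rewrite !inE => ->; rewrite andbT; apply/imsetP; exists c.
apply: eq_bigr => w; rewrite inE => /andP[wI Xw]; rewrite -(card_fiber wI) sum1dep_card.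
by apply: eq_card => c; rewrite !inE andb_idl // => /eqP->.
Qed.

Lemma mulW_image d e : (N.*2 < e)%N ->
  mulW e @: image_res d \subset image_res (d + e) /\ #|mulW e @: image_res d| = #|image_res d|.
Proof.
move=> lt_e; split.
  apply/subsetP => _ /imsetP[_ /imsetP[c _ ->] ->]; rewrite -residues_mulW.
  apply/imsetP; exists (coefs_of (d + e) (poly_of_coefs c * mform e)) => //.
  rewrite poly_of_coefsK //.
  exact: homogM (poly_of_coefs_homog c) (mform_homog lt_e) _.
apply: card_in_imset => _ _ /imsetP[c _ ->] /imsetP[c' _ ->]; exact: mulW_inj.
Qed.

(** Equal cardinalities make [mulW e] a bijection between the two images; it preserves tangency, and
    constant fibre size turns this into equality of proportions. *)
Lemma cnt_stable_step d e : (N.*2 < e)%N -> #|image_res (d + e)| = #|image_res d| ->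
  (@cnt F d (tangent_all r) * @cnt F (d + e) xpredT
   = @cnt F (d + e) (tangent_all r) * @cnt F d xpredT)%N.
Proof.
move=> lt_e eqI; have [sub cardI] := mulW_image d lt_e.
have eI : mulW e @: image_res d = image_res (d + e).
  by apply/eqP; rewrite eqEcard sub cardI eqI leqnn.
have cntE k : @cnt F k (tangent_all r) = (#|[set w in image_res k | tangent_res w]| * kernel_res k)%N.
  by rewrite -cnt_residues; apply: eq_cnt => f _; rewrite tangent_residues.
have totE k : @cnt F k xpredT = (#|image_res k| * kernel_res k)%N.
  rewrite (cnt_residues k xpredT); congr (_ * _)%N; apply: eq_card => w.
  by rewrite inE andbT.
have eT : #|[set w in image_res (d + e) | tangent_res w]|
    = #|[set w in image_res d | tangent_res w]|.
  rewrite -(card_in_imset (f := mulW e) (D := [set w in image_res d | tangent_res w])).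
    apply: eq_card => w; rewrite inE -eI; apply/andP/imsetP => [[/imsetP[w' w'I ->]]|[w']].
      by rewrite tangent_res_mulW // => tw; exists w' => //; rewrite inE w'I.
    rewrite inE => /andP[w'I tw ->]; rewrite tangent_res_mulW //; split=> //.
    exact: imset_f.
  move=> w w'; rewrite !inE => /andP[/imsetP[c _ ->] _] /andP[/imsetP[c' _ ->] _].
  exact: mulW_inj.
rewrite !cntE !totE eT eqI; ring.
Qed.

Lemma bounded_max (g : nat -> nat) B : (forall d, g d <= B)%N ->
  exists d0, forall d, (g d <= g d0)%N.
Proof.
move=> leB; suff H k d : (B - g d <= k)%N -> exists d0, forall d, (g d <= g d0)%N.
  exact: (H _ 0%N (leqnn _)).
elim: k d => [|k IHk] d le_k.
  by exists d => d'; apply: leq_trans (leB d') _; rewrite -subn_eq0 -leqn0.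
have [[d' lt_d]|nex] := Classical_Prop.classic (exists d', (g d < g d')%N).
  by apply: (IHk d'); move: (leB d') lt_d le_k; lia.
by exists d => d'; rewrite leqNgt; apply/negP => lt_d; apply: nex; exists d'.
Qed.

(** Choose [d0] with the largest image of residues. That image embeds in those of all degrees beyond
    [d0 + N.*2], so their sizes agree. *)
Lemma cnt_stable : exists d0 D, forall d, (D <= d)%N ->
  (@cnt F d (tangent_all r) * @cnt F d0 xpredT
   = @cnt F d0 (tangent_all r) * @cnt F d xpredT)%N.
Proof.
have [d0 maxd] := bounded_max (fun d => max_card (mem (image_res d))).
exists d0, (d0 + N.*2.+1)%N => d le_d.
have -> : d = (d0 + (d - d0))%N by lia.
have lt_e : (N.*2 < d - d0)%N by lia.
symmetry; apply: cnt_stable_step => //; apply/eqP; rewrite eqn_leq maxd /=.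
by have [sub <-] := mulW_image d0 lt_e; apply: subset_leq_card.
Qed.

End FixedBound.
End Stability.

(** * The density *)

Lemma asboolE (P : Prop) (b : bool) : (P <-> b) -> asbool P = b.
Proof.
rewrite /asbool => Pb.
by case: ClassicalEpsilon.excluded_middle_informative => [/Pb->|nP] //;
   apply/esym/negP => /Pb.
Qed.

Lemma transverse_freeE (F : finFieldType) d (f : {mpoly F[3]}) :
  f \is d.-homog -> (0 < d)%N -> asbool (transverse_free f) = tangent_all d f.
Proof.
move=> hf d0; apply: asboolE; split=> [tf|/tangent_allP tf].
  by apply/tangent_allP => P Q rf; apply/(transverseP P Q hf d0)/tf.
by move=> P Q rf; apply/(transverseP P Q hf d0)/tf.
Qed.

From Stdlib Require Import Rdefinitions Raxioms RIneq Rfunctions Rseries.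
From Stdlib Require Import Rcomplete Rbasic_fun Lra.

Local Open Scope R_scope.

Lemma INR_leq (m n : nat) : leq m n -> INR m <= INR n.
Proof. by move=> /ssrnat.leP; apply: le_INR. Qed.

Lemma INR_muln (m n : nat) : INR (muln m n) = INR m * INR n.
Proof. exact: mult_INR. Qed.

Lemma INR_expn (m n : nat) : INR (expn m n) = INR m ^ n.
Proof. by elim: n => //= n IHn; rewrite expnS INR_muln IHn. Qed.

Lemma ratio_le (a b v x : nat) : (leq 1 v) -> (leq 1 x) -> leq (muln a x) (muln b v) ->
  INR a / INR v <= INR b / INR x.
Proof.
move=> v0 x0 /INR_leq; rewrite !INR_muln.
have v1 : 0 < INR v by apply: lt_0_INR; apply/ssrnat.ltP.
have x1 : 0 < INR x by apply: lt_0_INR; apply/ssrnat.ltP.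
move=> h; apply: (Rmult_le_reg_r (INR v * INR x)); first exact: Rmult_lt_0_compat.
have -> : INR a / INR v * (INR v * INR x) = INR a * INR x by field; lra.
by have -> : INR b / INR x * (INR v * INR x) = INR b * INR v by field; lra.
Qed.

(** Tails confined to intervals of length [eps r] make [u] Cauchy; as [u n <= b + eps r] eventually,
    the limit cannot exceed [b]. *)
Lemma sandwich_limit (u : nat -> R) (eps : nat -> R) (b : R) :
  (forall e, 0 < e -> exists r, eps r < e) ->
  (forall r, exists c D, c <= b /\
     forall n, leq D n -> c <= u n <= c + eps r) ->
  exists L, Un_cv u L /\ L <= b.
Proof.
move=> small sand.
have cauchy : Cauchy_crit u.
  move=> e e0; have [r er] := small e e0; have [c [D [_ h]]] := sand r.
  exists D => n m /ssrnat.leP/h hn /ssrnat.leP/h hm.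
  rewrite /Rdist; apply: Rabs_def1; lra.
have [L cvL] := R_complete u cauchy; exists L; split=> //.
apply: Rnot_lt_le => lt_bL; pose e := (L - b) / 2.
have e0 : 0 < e by rewrite /e; lra.
have [r er] := small e e0; have [c [D [cb h]]] := sand r.
have [N hN] := cvL e e0.
pose n := maxn D N.
have := hN n (ssrnat.leP (leq_maxr D N)); rewrite /Rdist => /Rabs_def2[_ lo].
have := h n (leq_maxl D N); rewrite /e in lo er; lra.
Qed.

Theorem mainTheorem10 (F : finFieldType) :
  exists L : R, Un_cv (omega_seq F) L /\ Rle L (omega_bound #|F|).
Proof.
have q1 : leq 2 #|F| by exact: card_finField_gt1.
have q1R : 1 < INR #|F| by apply: (lt_1_INR); apply/ssrnat.ltP.
have tot0 d : leq 1 #|{ffun mon d -> F}| by apply/card_gt0P; exists (coefs_of d GRing.zero).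
pose prop r d := INR (@cnt F d (tangent_all r)) / INR #|{ffun mon d -> F}|.
(* In degree [n.+1] truncation at [n.+1] is exact, by [transverse_freeE]. *)
have omegaE n : omega_seq F n = prop n.+1 n.+1.
  rewrite /omega_seq /omega_ratio /prop /Rdiv; congr (INR _ * _).
  by apply: eq_card => c; rewrite !inE (transverse_freeE (poly_of_coefs_homog c)).
(* The truncation level is [r.+1], hence positive, and the error is the tail bound
   [q^6 / q^(r+1)]. *)
apply: (@sandwich_limit _ (fun r => INR #|F| ^ 6 * (/ INR #|F|) ^ r.+1)).
  move=> e e0; have q6 : 0 < INR #|F| ^ 6 by apply: pow_lt; lra.
  have [||N hN] := @pow_lt_1_zero (/ INR #|F|) _ (e / INR #|F| ^ 6).
  - rewrite Rabs_right; first by rewrite -Rinv_1; apply: Rinv_lt_contravar; lra.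
    by apply/Rle_ge/Rlt_le/Rinv_0_lt_compat; lra.
  - by apply: Rdiv_lt_0_compat.
  exists N; have := hN N.+1 (le_S _ _ (le_n _)) => /Rabs_def2[h _].
  have := Rmult_lt_compat_l _ _ _ q6 h.
  by have -> : INR #|F| ^ 6 * (e / INR #|F| ^ 6) = e by field; lra.
move=> r; have [d0 [D stable]] := cnt_stable F r.+1.
(* Beyond [D'] the truncated proportion is constant, the degree is at least [r.+1], and the upper
   bound applies. *)
pose D' := maxn D (maxn r.+1 (sq_deg F r.+1 + #|F|).+1).
have propE d : leq D' d -> prop r.+1 d = prop r.+1 d0.
  move=> le_d; have := stable d _; rewrite !cntT => h.
  have {}h := h (leq_trans (leq_maxl _ _) le_d).
  by apply: Rle_antisym; apply: ratio_le => //; rewrite h.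
exists (prop r.+1 d0), D'; split.
  (* The degree [d0] may be too small for the estimate, so the constant is evaluated in degree
     [D']. *)
  rewrite -(propE D' (leqnn _)) /omega_bound.
  have large : leq (S (sq_deg F r.+1 + #|F|)) D'.
    by rewrite /D' !leq_max leqnn !orbT.
  have := cnt_tangent_all (ltn0Sn r) large; rewrite cntT => h.
  rewrite -INR_expn -[X in expn _ X]addn1 in h *.
  by apply: ratio_le => //; rewrite expn_gt0 (ltnW q1).
move=> n le_n; have le_n1 : leq D' n.+1 by apply: leq_trans le_n _.
rewrite omegaE -(propE n.+1 le_n1).
have le_r : leq r.+1 n.+1.
  by apply: leq_trans le_n1; rewrite /D' !leq_max leqnn !orbT.
split.
  apply: Rmult_le_compat_r.
    by apply/Rlt_le/Rinv_0_lt_compat; apply: lt_0_INR; apply/ssrnat.ltP.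
  by apply: INR_leq; apply: leq_cnt => f _; apply: tangent_all_le.
have t1 : 0 < INR #|{ffun mon n.+1 -> F}| by apply: lt_0_INR; apply/ssrnat.ltP.
have := cnt_tail F n.+1 (ltn0Sn r); rewrite cntT => tail.
have qr : leq 1 (expn #|F| r.+1) by rewrite expn_gt0 (ltnW q1).
have := ratio_le (tot0 n.+1) qr tail; rewrite !INR_expn => {}tail.
rewrite pow_inv; apply: Rle_trans (Rplus_le_compat_l _ _ _ tail).
rewrite /prop -Rdiv_plus_distr -plus_INR; apply: Rmult_le_compat_r.
  by apply/Rlt_le/Rinv_0_lt_compat.
apply: INR_leq; rewrite (cnt_predC _ _ (tangent_all r.+1)) leq_add2r.
by apply: leq_cnt => f _ /andP[].
Qed.
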